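(* Let $0<\alpha\leq 1$. If $b,p,c\in\mathbb{R}$ and $k=p+\frac{b+1}{2}$ satisfy $$|c|<4\alpha(k-1)$$ and $u_p(z)\neq 0$ for $z\in\mathbb{D}$, then $u_p(z)\prec\left(\frac{1+z}{1-z}\right)^{\alpha}$.
   Context: $\mathbb{D}$ is the open unit disc in $\mathbb{C}$. The generalized and normalized Bessel function of the first kind of order $p$ is $u_p(z)=u_{p,b,c}(z)=\sum_{n=0}^{\infty}\frac{(-c/4)^n}{(k)_n}\frac{z^n}{n!}$, where $b,p,c\in\mathbb{C}$, $k=p+(b+1)/2$ and $k\neq 0,-1,-2,\ldots$; here $(\lambda)_n$ is the Pochhammer symbol, $(\lambda)_0=1$, $(\lambda)_n=\lambda(\lambda+1)_{n-1}$. For analytic functions $f,g$ on $\mathbb{D}$, $f\prec g$ ($f$ is subordinate to $g$) means there is an analytic $w:\mathbb{D}\to\mathbb{D}$ with $w(0)=0$ and $f(z)=g(w(z))$ for all $z\in\mathbb{D}$. The power $\left(\frac{1+z}{1-z}\right)^{\alpha}$ is the principal branch (value $1$ at $z=0$). *)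

(* Defs.v *)
From Stdlib Require Import Reals Factorial.
From Coquelicot Require Import Coquelicot.

Local Open Scope C_scope.

Fixpoint pochhammer (l : C) (n : nat) : C :=
  match n with
  | O => 1
  | S m => l * pochhammer (l + 1) m
  end.

Definition bessel_k (p b : C) : C := p + (b + 1) / 2.

Definition bessel_coeff (p b c : C) (n : nat) : C :=
  (- c / 4) ^ n / pochhammer (bessel_k p b) n / INR (fact n).

(* [iota] selects the sum of the power series. When [bessel_k p b] is not in
   {0, -1, -2, ...}, the series converges for every [z]; otherwise some
   coefficients involve a division by zero and the value is meaningless. *)
Definition bessel_u (p b c z : C) : C :=
  iota (T := C_CompleteNormedModule)
    (is_pseries (K := C_AbsRing) (V := C_NormedModule)
       (bessel_coeff p b c) z).

Definition in_disc (z : C) : Prop := (Cmod z < 1)%R.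

(* Complex differentiability: the scalar field of [ex_derive] is C, not R. *)
Definition analytic_on_disc (f : C -> C) : Prop :=
  forall z : C, in_disc z ->
    ex_derive (K := C_AbsRing) (V := C_NormedModule) f z.

(* Functions on the disc are represented by total functions on C, of which
   only the values on the disc matter. *)
Definition subordinate (f g : C -> C) : Prop :=
  analytic_on_disc f /\ analytic_on_disc g /\
  exists w : C -> C,
    analytic_on_disc w /\
    (forall z : C, in_disc z -> in_disc (w z)) /\
    w 0 = 0 /\
    (forall z : C, in_disc z -> f z = g (w z)).

(* Principal argument, with values in (-PI, PI]; meaningless at 0. *)
Definition Carg (z : C) : R :=
  if Rle_dec 0 (Im z) then acos (Re z / Cmod z) else (- acos (Re z / Cmod z))%R.

Definition Cexp (z : C) : C :=
  ((exp (Re z) * cos (Im z))%R, (exp (Re z) * sin (Im z))%R).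

Definition Clog (z : C) : C := (ln (Cmod z), Carg z).

(* Principal branch of the complex power; meaningless for [z = 0]. *)
Definition Cpower (z a : C) : C := Cexp (a * Clog z).

(* Main.v *)
Require Import Defs.
From Stdlib Require Import Reals.
From Coquelicot Require Import Coquelicot.
From Stdlib Require Import Lra Lia Factorial.

(** Write [u] for the normalized Bessel function, so that
    [z u'' + k u' + (c/4) u = 0]. On a ray [t |-> u(tz)], the quantity
    [|u'|^2 - alpha^2 |u|^2] is negative at [t = 0]; at a first zero with [t > 0]
    the differential equation and [|c|/4 < alpha (k - 1)], [alpha <= 1] force its
    derivative to be negative. Hence [|u'/u| < alpha] on the disc, so that
    [|arg u| < alpha < alpha PI/2]. Then [P = u^(1/alpha)] is holomorphic
    with values in the right half-plane, and [w = (P - 1)/(P + 1)] realizes the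
    subordination. *)

Local Open Scope R_scope.

(** * Complex derivatives *)

(** At a first zero of [|u'|^2 - alpha^2 |u|^2] every term is measured against [|u|^2]: the damping
    term [k u'] wins over the term in [c] and over the growth of [|u|^2], because [|c|/4 - k alpha +
    alpha^2 < alpha (alpha - 1) <= 0]. The zero-freeness of [u] makes [|u|^2] positive, hence the
    inequality strict. The starting value is read off the equation at the origin, where [z u'']
    drops out. Passing from [u'/u] to the argument of [u] uses no integral of a logarithm: a second
    barrier compares [Re u] with [|u|] times the cosine of a moving phase, so the jump of the
    principal argument never enters. The room between [1] and [PI / 2] lets that phase start at a
    positive angle. The resulting bound also puts [u] itself in the right half-plane, the only
    region where [Clog] is differentiated. *)

Definition has_C_derivative (f : C -> C) (z l : C) : Prop :=
  forall eps : R, 0 < eps -> exists delta : R, 0 < delta /\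
    forall h : C, Cmod h < delta ->
      Cmod (f (z + h) - f z - l * h)%C <= eps * Cmod h.

Lemma has_C_derivative_ex_derive (f : C -> C) (z l : C) :
  has_C_derivative f z l -> ex_derive (K := C_AbsRing) (V := C_NormedModule) f z.
Proof.
  intros H. exists l. split.
  - apply (is_linear_scal_l (K := C_AbsRing) (V := C_NormedModule)).
  - intros x Hx eps.
    (* Limits of the neighbourhood filter are unique, so the point [x] of the domination condition
       is [z] itself. *)
    apply (is_filter_lim_locally_unique (K := C_AbsRing)
             (V := AbsRing_NormedModule C_AbsRing)) in Hx. subst x.
    destruct (H eps (cond_pos eps)) as [d [Hd Hb]].
    exists (mkposreal d Hd). intros y Hy.
    change (Cmod (y - z)%C < d) in Hy.
    change (Cmod (f y - f z - (y - z) * l)%C <= eps * Cmod (y - z)%C).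
    specialize (Hb _ Hy).
    assert (E : forall w : C, (z + (w - z))%C = w) by (intros; ring).
    rewrite E in Hb. rewrite (Cmult_comm (y - z) l). exact Hb.
Qed.

Lemma Cmod_minus_le (a b : C) : Cmod a - Cmod b <= Cmod (a - b)%C.
Proof.
  generalize (Cmod_triangle (a - b)%C b).
  replace (a - b + b)%C with a by ring. lra.
Qed.

Lemma has_C_derivative_ext_loc (f g : C -> C) (z l : C) (r : R) :
  0 < r -> (forall w, Cmod (w - z)%C < r -> f w = g w) ->
  has_C_derivative f z l -> has_C_derivative g z l.
Proof.
  intros Hr He H eps Heps. destruct (H eps Heps) as [d [Hd Hb]].
  exists (Rmin d r). split. { apply Rmin_pos; assumption. }
  intros h Hh.
  rewrite <- !He.
  - apply Hb. apply Rlt_le_trans with (1 := Hh). apply Rmin_l.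
  - replace (z - z)%C with (RtoC 0) by ring. rewrite Cmod_0. exact Hr.
  - replace (z + h - z)%C with h by ring.
    apply Rlt_le_trans with (1 := Hh). apply Rmin_r.
Qed.

Lemma has_C_derivative_affine (a b z : C) :
  has_C_derivative (fun w => a * w + b)%C z a.
Proof.
  intros eps Heps. exists 1. split. lra. intros h _.
  replace (a * (z + h) + b - (a * z + b) - a * h)%C with (RtoC 0) by ring.
  rewrite Cmod_0. apply Rmult_le_pos; [lra | apply Cmod_ge_0].
Qed.

Lemma has_C_derivative_lipschitz (f : C -> C) (z l : C) :
  has_C_derivative f z l -> exists delta, 0 < delta /\
    forall h, Cmod h < delta -> Cmod (f (z + h) - f z)%C <= (Cmod l + 1) * Cmod h.
Proof.
  intros H. destruct (H 1 Rlt_0_1) as [d [Hd Hb]]. exists d. split; [exact Hd|].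
  intros h Hh. specialize (Hb h Hh).
  generalize (Cmod_minus_le (f (z + h) - f z)%C (l * h)%C).
  rewrite Cmod_mult. lra.
Qed.

(** The error is the outer error at the increment [k] of [g] plus [df] times the inner error. Since
    [has_C_derivative] involves no quotient, [k = 0] needs no separate case. *)
Lemma has_C_derivative_comp (f g : C -> C) (z df dg : C) :
  has_C_derivative f (g z) df -> has_C_derivative g z dg ->
  has_C_derivative (fun w => f (g w)) z (df * dg)%C.
Proof.
  intros Hf Hg eps Heps.
  assert (P1 := Cmod_ge_0 df). assert (P2 := Cmod_ge_0 dg).
  destruct (has_C_derivative_lipschitz _ _ _ Hg) as [d1 [Hd1 B1]].
  set (e1 := eps / (2 * (Cmod dg + 1))).
  set (e2 := eps / (2 * (Cmod df + 1))).
  assert (E1 : e1 * (Cmod dg + 1) = eps / 2) by (unfold e1; field; lra).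
  assert (E2 : e2 * (Cmod df + 1) = eps / 2) by (unfold e2; field; lra).
  assert (Q1 : 0 < e1) by (apply Rdiv_lt_0_compat; lra).
  assert (Q2 : 0 < e2) by (apply Rdiv_lt_0_compat; lra).
  destruct (Hf e1 Q1) as [d2 [Hd2 B2]].
  destruct (Hg e2 Q2) as [d3 [Hd3 B3]].
  exists (Rmin (Rmin d1 d3) (d2 / (Cmod dg + 1))). split.
  { repeat apply Rmin_pos; try assumption. apply Rdiv_lt_0_compat; lra. }
  intros h Hh.
  assert (h1 : Cmod h < d1).
  { eapply Rlt_le_trans; [exact Hh|]. eapply Rle_trans; [apply Rmin_l|apply Rmin_l]. }
  assert (h3 : Cmod h < d3).
  { eapply Rlt_le_trans; [exact Hh|]. eapply Rle_trans; [apply Rmin_l|apply Rmin_r]. }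
  assert (h2 : (Cmod dg + 1) * Cmod h < d2).
  { assert (Cmod h < d2 / (Cmod dg + 1)).
    { eapply Rlt_le_trans; [exact Hh|apply Rmin_r]. }
    replace d2 with ((Cmod dg + 1) * (d2 / (Cmod dg + 1))) by (field; lra).
    apply Rmult_lt_compat_l; lra. }
  specialize (B1 h h1). specialize (B3 h h3).
  set (k := (g (z + h) - g z)%C) in *.
  specialize (B2 k (Rle_lt_trans _ _ _ B1 h2)).
  replace (g z + k)%C with (g (z + h)%C) in B2 by (unfold k; ring).
  replace (f (g (z + h)) - f (g z) - df * dg * h)%C
    with ((f (g (z + h)) - f (g z) - df * k) + df * (k - dg * h))%C by ring.
  eapply Rle_trans; [apply Cmod_triangle|]. rewrite Cmod_mult.
  assert (P3 := Cmod_ge_0 h).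
  assert (e1 * Cmod k <= eps / 2 * Cmod h).
  { rewrite <- E1, Rmult_assoc. apply Rmult_le_compat_l; lra. }
  assert (Cmod df * Cmod (k - dg * h)%C <= eps / 2 * Cmod h).
  { rewrite <- E2. apply Rle_trans with ((Cmod df + 1) * (e2 * Cmod h)); [|lra].
    apply Rmult_le_compat; try lra. apply Cmod_ge_0. }
  lra.
Qed.

(** With [D] the increment of [G], differentiability of [F] reads [h = d D + o(D)]. Continuity of
    [G] makes [D] small enough to use this, and then [|D| <= 2 |h| / |d|] turns [o(D)] into
    [o(h)]. *)
Lemma has_C_derivative_inverse_function (F G : C -> C) (z d : C) (r : R) :
  0 < r -> d <> 0%C -> has_C_derivative F (G z) d ->
  (forall w, Cmod (w - z)%C < r -> F (G w) = w) ->
  (forall eps, 0 < eps -> exists delta, 0 < delta /\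
     forall h, Cmod h < delta -> Cmod (G (z + h) - G z)%C < eps) ->
  has_C_derivative G z (/ d)%C.
Proof.
  intros Hr Hd HF HFG HG eps Heps.
  assert (Pd : 0 < Cmod d) by (apply Cmod_gt_0; exact Hd).
  (* The first bound yields [|d| |D| <= 2 |h|]; the second, combined with that inequality, yields
     the required [eps]. *)
  set (e1 := Rmin (Cmod d / 2) (eps * (Cmod d * Cmod d) / 2)).
  assert (Q1 : 0 < e1).
  { apply Rmin_pos; [lra|]. assert (0 < eps * (Cmod d * Cmod d)); [|lra].
    repeat apply Rmult_lt_0_compat; lra. }
  destruct (HF e1 Q1) as [d1 [Hd1 B1]].
  destruct (HG d1 Hd1) as [d2 [Hd2 B2]].
  exists (Rmin d2 r). split. { apply Rmin_pos; assumption. }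
  intros h Hh.
  assert (h2 : Cmod h < d2) by (eapply Rlt_le_trans; [exact Hh|apply Rmin_l]).
  assert (h3 : Cmod h < r) by (eapply Rlt_le_trans; [exact Hh|apply Rmin_r]).
  specialize (B1 _ (B2 h h2)). set (D := (G (z + h) - G z)%C) in *.
  replace (G z + D)%C with (G (z + h)%C) in B1 by (unfold D; ring).
  rewrite !HFG in B1.
  2: { replace (z - z)%C with (RtoC 0) by ring. rewrite Cmod_0; lra. }
  2: { replace (z + h - z)%C with h by ring. exact h3. }
  replace (z + h - z - d * D)%C with (h - d * D)%C in B1 by ring.
  assert (PD := Cmod_ge_0 D). assert (Ph := Cmod_ge_0 h).
  assert (D1 : Cmod d * Cmod D <= 2 * Cmod h).
  { generalize (Cmod_minus_le (d * D)%C h).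
    replace (d * D - h)%C with (- (h - d * D))%C by ring.
    rewrite Cmod_opp, Cmod_mult.
    assert (e1 * Cmod D <= Cmod d / 2 * Cmod D).
    { apply Rmult_le_compat_r; [lra|apply Rmin_l]. }
    lra. }
  replace (D - / d * h)%C with (- (/ d * (h - d * D)))%C by (field; exact Hd).
  rewrite Cmod_opp, Cmod_mult, Cmod_inv by exact Hd.
  apply Rmult_le_reg_l with (Cmod d); [lra|].
  rewrite <- Rmult_assoc, Rinv_r, Rmult_1_l by lra.
  eapply Rle_trans; [exact B1|].
  apply Rle_trans with (eps * (Cmod d * Cmod d) / 2 * Cmod D).
  { apply Rmult_le_compat_r; [lra|apply Rmin_r]. }
  replace (eps * (Cmod d * Cmod d) / 2 * Cmod D)
    with (eps * Cmod d * (Cmod d * Cmod D) / 2) by field.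
  assert (eps * Cmod d * (Cmod d * Cmod D) <= eps * Cmod d * (2 * Cmod h)).
  { apply Rmult_le_compat_l; [|lra]. apply Rmult_le_pos; lra. }
  lra.
Qed.

(* |1/(z+h) - 1/z + h/z^2| = |h|^2 / (|z|^2 |z+h|), and |z+h| >= |z|/2. *)
Lemma has_C_derivative_Cinv (z : C) :
  z <> 0%C -> has_C_derivative Cinv z (- / (z * z))%C.
Proof.
  intros Hz eps Heps.
  assert (Pz : 0 < Cmod z) by (apply Cmod_gt_0; exact Hz).
  exists (Rmin (Cmod z / 2) (eps * (Cmod z * Cmod z * Cmod z) / 2)). split.
  { apply Rmin_pos; [lra|]. assert (0 < eps * (Cmod z * Cmod z * Cmod z)); [|lra].
    repeat apply Rmult_lt_0_compat; lra. }
  intros h Hh.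
  assert (h1 : Cmod h < Cmod z / 2) by (eapply Rlt_le_trans; [exact Hh|apply Rmin_l]).
  assert (h2 : Cmod h < eps * (Cmod z * Cmod z * Cmod z) / 2)
    by (eapply Rlt_le_trans; [exact Hh|apply Rmin_r]).
  assert (h3 : Cmod z / 2 <= Cmod (z + h)%C).
  { generalize (Cmod_minus_le z (- h)%C). rewrite Cmod_opp.
    replace (z - - h)%C with (z + h)%C by ring. lra. }
  assert (Hzh : (z + h)%C <> 0%C).
  { apply Cmod_gt_0. lra. }
  replace (/ (z + h) - / z - - / (z * z) * h)%C with (h * h / (z * z * (z + h)))%C
    by (field; split; assumption).
  rewrite Cmod_div, !Cmod_mult.
  2: { repeat apply Cmult_neq_0; assumption. }
  set (m := Cmod z) in *. set (n := Cmod (z + h)%C) in *.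
  assert (Ph := Cmod_ge_0 h). set (t := Cmod h) in *.
  apply Rmult_le_reg_r with (m * m * n).
  { repeat apply Rmult_lt_0_compat; lra. }
  unfold Rdiv. rewrite Rmult_assoc, Rinv_l, Rmult_1_r.
  2: { apply Rgt_not_eq. repeat apply Rmult_lt_0_compat; lra. }
  replace (eps * t * (m * m * n)) with (t * (eps * (m * m) * n)) by ring.
  apply Rmult_le_compat_l; [lra|].
  apply Rle_trans with (eps * (m * m) * (m / 2)); [lra|].
  apply Rmult_le_compat_l; [|lra]. apply Rmult_le_pos; [lra|]. apply Rmult_le_pos; lra.
Qed.

(** * Second-order bounds and the derivative of the complex exponential *)

Lemma Cmod_le_Rabs_Re_Im (z : C) : Cmod z <= Rabs (Re z) + Rabs (Im z).
Proof.
  replace z with (RtoC (Re z) + Ci * RtoC (Im z))%C at 1.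
  2: { destruct z as [x y]. unfold Ci, RtoC, Cplus, Cmult; simpl. f_equal; ring. }
  eapply Rle_trans; [apply Cmod_triangle|].
  rewrite Cmod_mult, !Cmod_R.
  replace (Cmod Ci) with 1. lra.
  unfold Cmod, Ci; simpl. replace (0 * (0 * 1) + 1 * (1 * 1)) with 1 by ring.
  rewrite sqrt_1. reflexivity.
Qed.

Lemma Im_le_Cmod (z : C) : Rabs (Im z) <= Cmod z.
Proof.
  unfold Cmod. rewrite <- sqrt_Rsqr_abs. apply sqrt_le_1_alt.
  unfold Rsqr, Im. generalize (pow2_ge_0 (fst z)). simpl. lra.
Qed.

(** The tangent inequality at [x] is the lower bound. At [-x] it gives [exp x * (1 - x) <= 1], and
    [(1 + x + 2 x^2) (1 - x) = 1 + x^2 (1 - 2 x) >= 1] for [x <= 1/2]. *)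
Lemma Rabs_exp_quadratic (x : R) : Rabs x <= / 2 -> Rabs (exp x - 1 - x) <= 2 * (x * x).
Proof.
  intros Hx. apply Rabs_le_between in Hx.
  assert (H1 := exp_ineq1_le x). assert (H2 := exp_ineq1_le (- x)).
  assert (H3 : exp x * exp (- x) = 1) by (rewrite <- exp_plus, Rplus_opp_r; apply exp_0).
  assert (H4 := exp_pos x).
  apply Rabs_le. split; [nra|].
  assert (exp x * (1 - x) <= 1) by nra.
  assert (exp x <= 1 + x + 2 * (x * x)); [|lra].
  apply Rmult_le_reg_r with (1 - x); [lra|].
  apply Rle_trans with (1 := H). nra.
Qed.

Lemma Rabs_sin_le (y : R) : Rabs (sin y) <= Rabs y.
Proof.
  assert (H : forall y, 0 <= y -> Rabs (sin y) <= y).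
  { intros x Hx. destruct (Req_dec x 0) as [->|Hx0].
    - rewrite sin_0, Rabs_R0. lra.
    - assert (sin x < x) by (apply sin_lt_x; lra).
      destruct (Rle_dec x 1).
      + assert (0 <= sin x). { apply sin_ge_0; [lra|]. generalize PI2_1. lra. }
        rewrite Rabs_pos_eq; lra.
      + generalize (SIN_bound x). intros. apply Rabs_le. lra. }
  destruct (Rle_dec 0 y).
  - rewrite (Rabs_pos_eq y) by assumption. apply H; assumption.
  - rewrite <- (Rabs_Ropp y), <- Rabs_Ropp, <- sin_neg.
    rewrite (Rabs_pos_eq (- y)) by lra. apply H; lra.
Qed.

Lemma Rabs_cos_quadratic (y : R) : Rabs (cos y - 1) <= y * y / 2.
Proof.
  replace y with (2 * (y / 2)) at 1 by field. rewrite cos_2a_sin.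
  assert (H := Rabs_sin_le (y / 2)). apply Rsqr_le_abs_1 in H. unfold Rsqr in H.
  apply Rabs_le. nra.
Qed.

Lemma Rabs_sin_quadratic (y : R) : Rabs y <= / 2 -> Rabs (sin y - y) <= y * y.
Proof.
  assert (H : forall y, 0 <= y <= / 2 -> Rabs (sin y - y) <= y * y).
  { intros x Hx.
    (* Order [0] of the alternating bound is [x - x^3 / 6 <= sin x]; on [[0, 1/2]] the cubic term is
       below [x^2]. *)
    assert (B := sin_bound x 0). destruct B as [B _]; [lra|generalize PI2_1; lra|].
    unfold sin_approx, sin_term in B. simpl in B.
    assert (sin x <= x).
    { generalize (Rabs_sin_le x). rewrite (Rabs_pos_eq x) by lra.
      intros; generalize (Rle_abs (sin x)); lra. }
    assert (x - x * x * x / 6 <= sin x). { eapply Rle_trans; [|exact B]. apply Req_le. field. }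
    apply Rabs_le. nra. }
  intros Hy. destruct (Rle_dec 0 y).
  - apply H. rewrite Rabs_pos_eq in Hy; lra.
  - rewrite <- Rabs_Ropp. replace (- (sin y - y)) with (sin (- y) - (- y)) by (rewrite sin_neg; ring).
    replace (y * y) with (- y * - y) by ring. apply H. rewrite Rabs_left in Hy; lra.
Qed.

Lemma Cexp_plus (a b : C) : Cexp (a + b)%C = (Cexp a * Cexp b)%C.
Proof.
  destruct a as [a1 a2], b as [b1 b2]. unfold Cexp, Cplus, Cmult; simpl.
  rewrite exp_plus, cos_plus, sin_plus. f_equal; ring.
Qed.

Lemma Cexp_quadratic (h : C) :
  Cmod h <= / 2 -> Cmod (Cexp h - 1 - h)%C <= 5 * (Cmod h * Cmod h).
Proof.
  intros Hh.
  assert (E : Cmod h * Cmod h = Re h * Re h + Im h * Im h).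
  { generalize (Cmod2_alt h). simpl. lra. }
  assert (Hx := re_le_Cmod h). assert (Hy := Im_le_Cmod h).
  rewrite E. destruct h as [x y]. unfold Re, Im in *; simpl in *.
  set (m := Cmod (x, y)) in *.
  eapply Rle_trans; [apply Cmod_le_Rabs_Re_Im|]. unfold Re, Im; simpl.
  assert (A1 := Rabs_exp_quadratic x ltac:(lra)).
  assert (A2 := Rabs_cos_quadratic y).
  assert (A3 := Rabs_sin_quadratic y ltac:(lra)).
  assert (Bx : -/2 <= x <= /2) by (apply Rabs_le_between; lra).
  assert (A4 : exp x <= 2).
  { apply Rabs_le_between in A1. nra. }
  assert (A5 := exp_pos x).
  assert (A6 : Rabs (exp x - 1) <= 2 * Rabs x).
  { replace (exp x - 1) with ((exp x - 1 - x) + x) by ring.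
    eapply Rle_trans; [apply Rabs_triang|].
    assert (x * x = Rabs x * Rabs x) by (rewrite <- Rabs_mult, Rabs_pos_eq; nra).
    assert (0 <= Rabs x) by apply Rabs_pos. nra. }
  (* Each part is regrouped into second-order pieces. They add up to at most [3 x^2 + 4 y^2], which
     the constant [5] covers. *)
  replace (exp x * cos y + - (1) + - x) with ((exp x - 1 - x) + exp x * (cos y - 1)) by ring.
  replace (exp x * sin y + - 0 + - y) with (exp x * (sin y - y) + (exp x - 1) * y) by ring.
  assert (C1 := Rabs_triang (exp x - 1 - x) (exp x * (cos y - 1))).
  assert (C2 := Rabs_triang (exp x * (sin y - y)) ((exp x - 1) * y)).
  rewrite !Rabs_mult, (Rabs_pos_eq (exp x)) in C1 by lra.
  rewrite !Rabs_mult, (Rabs_pos_eq (exp x)) in C2 by lra.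
  assert (D1 : exp x * Rabs (cos y - 1) <= y * y).
  { apply Rle_trans with (2 * (y * y / 2)); [|lra].
    apply Rmult_le_compat; try lra. apply Rabs_pos. }
  assert (D2 : exp x * Rabs (sin y - y) <= 2 * (y * y)).
  { apply Rmult_le_compat; try lra. apply Rabs_pos. }
  assert (D3 : Rabs (exp x - 1) * Rabs y <= x * x + y * y).
  { apply Rle_trans with (2 * Rabs x * Rabs y).
    - apply Rmult_le_compat_r; [apply Rabs_pos|lra].
    - assert (x * x = Rabs x * Rabs x) by (rewrite <- Rabs_mult, Rabs_pos_eq; nra).
      assert (y * y = Rabs y * Rabs y) by (rewrite <- Rabs_mult, Rabs_pos_eq; nra).
      generalize (Rle_0_sqr (Rabs x - Rabs y)). unfold Rsqr. lra. }
  generalize (Rle_0_sqr x) (Rle_0_sqr y). unfold Rsqr. lra.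
Qed.

Lemma has_C_derivative_Cexp (z : C) : has_C_derivative Cexp z (Cexp z).
Proof.
  intros eps Heps. assert (P := Cmod_ge_0 (Cexp z)).
  exists (Rmin (/ 2) (eps / (5 * (Cmod (Cexp z) + 1)))). split.
  { apply Rmin_pos; [lra|]. apply Rdiv_lt_0_compat; lra. }
  intros h Hh.
  assert (h1 : Cmod h < / 2) by (eapply Rlt_le_trans; [exact Hh|apply Rmin_l]).
  assert (h2 : Cmod h < eps / (5 * (Cmod (Cexp z) + 1)))
    by (eapply Rlt_le_trans; [exact Hh|apply Rmin_r]).
  rewrite Cexp_plus.
  replace (Cexp z * Cexp h - Cexp z - Cexp z * h)%C with (Cexp z * (Cexp h - 1 - h))%C by ring.
  rewrite Cmod_mult. assert (Ph := Cmod_ge_0 h).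
  apply Rle_trans with ((Cmod (Cexp z) + 1) * (5 * (Cmod h * Cmod h))).
  { apply Rmult_le_compat; try lra. apply Cmod_ge_0. apply Cexp_quadratic; lra. }
  replace ((Cmod (Cexp z) + 1) * (5 * (Cmod h * Cmod h)))
    with (5 * (Cmod (Cexp z) + 1) * Cmod h * Cmod h) by ring.
  apply Rmult_le_compat_r; [lra|].
  replace eps with (5 * (Cmod (Cexp z) + 1) * (eps / (5 * (Cmod (Cexp z) + 1)))) at 1 by (field; lra).
  apply Rmult_le_compat_l; lra.
Qed.

(** * The principal logarithm *)

Lemma Cmod_sqr (z : C) : Cmod z * Cmod z = Re z * Re z + Im z * Im z.
Proof. generalize (Cmod2_alt z). simpl. lra. Qed.

Lemma Re_div_Cmod_bound (z : C) : z <> 0%C -> -1 <= Re z / Cmod z <= 1.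
Proof.
  intros Hz. apply Cmod_gt_0 in Hz.
  apply Rabs_le_between. unfold Rdiv. rewrite Rabs_mult, (Rabs_pos_eq (/ _)).
  - apply Rmult_le_reg_r with (Cmod z); [lra|].
    rewrite Rmult_assoc, Rinv_l, Rmult_1_r, Rmult_1_l by lra. apply re_le_Cmod.
  - left. apply Rinv_0_lt_compat. exact Hz.
Qed.

Lemma cos_Carg (z : C) : z <> 0%C -> cos (Carg z) = Re z / Cmod z.
Proof.
  intros Hz. assert (B := Re_div_Cmod_bound z Hz). unfold Carg.
  destruct (Rle_dec 0 (Im z)); rewrite ?cos_neg; apply cos_acos; exact B.
Qed.

Lemma sin_Carg (z : C) : z <> 0%C -> sin (Carg z) = Im z / Cmod z.
Proof.
  intros Hz. assert (B := Re_div_Cmod_bound z Hz).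
  assert (E := Cmod_sqr z). apply Cmod_gt_0 in Hz.
  assert (S : sin (acos (Re z / Cmod z)) = Rabs (Im z) / Cmod z).
  { rewrite sin_acos by exact B.
    rewrite <- (Rabs_pos_eq (Cmod z)) at 2 by lra.
    rewrite <- Rabs_div by lra. rewrite <- sqrt_Rsqr_abs. f_equal. unfold Rsqr.
    apply Rmult_eq_reg_r with (Cmod z * Cmod z); [|nra].
    field_simplify; [|lra|lra]. simpl. lra. }
  unfold Carg. destruct (Rle_dec 0 (Im z)).
  - rewrite S, Rabs_pos_eq by assumption. reflexivity.
  - rewrite sin_neg, S, Rabs_left by lra. field. lra.
Qed.

Lemma Cexp_Clog (z : C) : z <> 0%C -> Cexp (Clog z) = z.
Proof.
  intros Hz. assert (P := proj1 (Cmod_gt_0 z) Hz).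
  unfold Cexp, Clog. unfold Re at 1 2, Im at 1 2. cbn [fst snd].
  rewrite exp_ln, cos_Carg, sin_Carg by assumption.
  destruct z as [x y]. unfold Re, Im. cbn [fst snd]. f_equal; field; lra.
Qed.

Lemma Cmod_Cexp (v : C) : Cmod (Cexp v) = exp (Re v).
Proof.
  assert (E : Cmod (Cexp v) * Cmod (Cexp v)
    = exp (Re v) * cos (Im v) * (exp (Re v) * cos (Im v))
      + exp (Re v) * sin (Im v) * (exp (Re v) * sin (Im v))) by exact (Cmod_sqr (Cexp v)).
  assert (T := sin2_cos2 (Im v)). unfold Rsqr in T.
  assert (P := exp_pos (Re v)). assert (Q := Cmod_ge_0 (Cexp v)).
  assert (Cmod (Cexp v) * Cmod (Cexp v) = exp (Re v) * exp (Re v)).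
  { rewrite E.
    replace (exp (Re v) * exp (Re v)) with
      (exp (Re v) * exp (Re v) * (sin (Im v) * sin (Im v) + cos (Im v) * cos (Im v)))
      by (rewrite T; ring). ring. }
  apply Rsqr_inj; [lra|lra|exact H].
Qed.

(** The sign of [Im (Cexp v)] is that of [sin (Im v)], hence of [Im v] in this strip, so [Carg]
    selects the right branch of [acos]. This is what allows the power [1 / alpha] to be undone
    later. *)
Lemma Clog_Cexp (v : C) : - PI < Im v < PI -> Clog (Cexp v) = v.
Proof.
  intros Hv. unfold Clog. rewrite Cmod_Cexp, ln_exp.
  assert (P := exp_pos (Re v)).
  assert (Hr : Re (Cexp v) / Cmod (Cexp v) = cos (Im v)).
  { rewrite Cmod_Cexp. unfold Cexp. unfold Re at 1. cbn [fst]. field. lra. }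
  rewrite (surjective_pairing v) at 3. unfold Re. f_equal.
  unfold Carg. rewrite Hr.
  destruct (Rle_dec 0 (Im (Cexp v))) as [H|H]; unfold Cexp in H; unfold Im at 1 in H; cbn [snd] in H.
  - apply acos_cos. split; [|unfold Im in *; lra].
    destruct (Rle_dec 0 (Im v)) as [|N]; [assumption|].
    assert (sin (Im v) < 0) by (apply sin_lt_0_var; lra). nra.
  - assert (Im v < 0).
    { destruct (Rle_dec 0 (Im v)) as [N|]; [|lra]. exfalso. apply H.
      apply Rmult_le_pos; [lra|]. apply sin_ge_0; lra. }
    rewrite <- cos_neg, acos_cos by lra. unfold Im. ring.
Qed.

(** On both branches [Rabs (Carg z)] is [acos (Re z / Cmod z)], and [cos] decreases on [[0, PI]]. A
    bound on the argument thus becomes an inequality between smooth quantities. *)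
Lemma Rabs_Carg_lt (z : C) (phi : R) :
  z <> 0%C -> 0 <= phi <= PI -> cos phi < Re z / Cmod z -> Rabs (Carg z) < phi.
Proof.
  intros Hz Hphi H. assert (B := Re_div_Cmod_bound z Hz).
  assert (A := acos_bound (Re z / Cmod z)).
  assert (acos (Re z / Cmod z) < phi).
  { rewrite <- (cos_acos (Re z / Cmod z)) in H by exact B.
    apply cos_decreasing_0 in H; lra. }
  unfold Carg. destruct (Rle_dec 0 (Im z)); rewrite ?Rabs_Ropp, Rabs_pos_eq; lra.
Qed.

(** Removes the case distinction in [Carg], which hides its continuity across the positive real
    axis. *)
Lemma Carg_right_half_plane (z : C) : 0 < Re z -> Carg z = atan (Im z / Re z).
Proof.
  intros H.
  assert (Hz : z <> 0%C). { intros ->. simpl in H. lra. }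
  assert (P := proj1 (Cmod_gt_0 z) Hz).
  assert (B : Rabs (Carg z) < PI / 2).
  { assert (0 < PI) by apply PI_RGT_0. apply Rabs_Carg_lt; [exact Hz|lra|].
    rewrite cos_PI2. apply Rdiv_lt_0_compat; lra. }
  apply Rabs_lt_between in B.
  rewrite <- (atan_tan (Carg z)) by lra. f_equal.
  unfold tan. rewrite cos_Carg, sin_Carg by exact Hz. field. lra.
Qed.

Lemma Clog_continuous (z : C) : 0 < Re z ->
  forall eps, 0 < eps -> exists delta, 0 < delta /\
    forall h, Cmod h < delta -> Cmod (Clog (z + h) - Clog z)%C < eps.
Proof.
  intros Hz eps Heps.
  assert (P : 0 < Cmod z) by (generalize (re_le_Cmod z) (Rle_abs (Re z)); lra).
  assert (CR : continuous (fun w : C => Re w) z).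
  { destruct z. apply continuous_fst. }
  assert (CI : continuous (fun w : C => Im w) z).
  { destruct z. apply continuous_snd. }
  assert (CM : continuous (fun w : C => sqrt (Re w * Re w + Im w * Im w)) z).
  { apply (continuous_comp (fun w : C => Re w * Re w + Im w * Im w) sqrt).
    - apply (continuous_plus (fun w : C => Re w * Re w) (fun w : C => Im w * Im w)).
      + apply (continuous_mult (fun w : C => Re w) (fun w : C => Re w)); assumption.
      + apply (continuous_mult (fun w : C => Im w) (fun w : C => Im w)); assumption.
    - apply continuous_sqrt. }
  assert (EM : forall w, sqrt (Re w * Re w + Im w * Im w) = Cmod w).
  { intros w. rewrite <- Cmod_sqr. apply sqrt_square, Cmod_ge_0. }
  assert (CL : continuous (fun w : C => ln (sqrt (Re w * Re w + Im w * Im w))) z).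
  { apply (continuous_comp (fun w : C => sqrt (Re w * Re w + Im w * Im w)) ln); [exact CM|].
    rewrite EM. apply continuity_pt_filterlim. apply derivable_continuous_pt.
    exists (/ Cmod z). apply derivable_pt_lim_ln. exact P. }
  assert (CA : continuous (fun w : C => atan (Im w / Re w)) z).
  { apply (continuous_comp (fun w : C => Im w / Re w) atan).
    - apply (continuous_mult (fun w : C => Im w) (fun w : C => / Re w)); [exact CI|].
      apply (continuous_comp (fun w : C => Re w) Rinv); [exact CR|].
      apply continuous_Rinv. lra.
    - apply continuity_pt_filterlim. apply derivable_continuous_pt, derivable_pt_atan. }
  assert (Q : 0 < eps / 2) by lra.
  unfold continuous in CL, CA.
  destruct (proj1 (filterlim_locally _ _) CL (mkposreal _ Q)) as [d1 H1].
  destruct (proj1 (filterlim_locally _ _) CA (mkposreal _ Q)) as [d2 H2].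
  (* The bound [Re z] keeps [z + h] in the right half-plane, where the [atan] formula applies. *)
  exists (Rmin (Re z) (Rmin d1 d2)). split.
  { repeat apply Rmin_pos; [exact Hz|apply cond_pos|apply cond_pos]. }
  intros h Hh.
  assert (h0 : Cmod h < Re z) by (eapply Rlt_le_trans; [exact Hh|apply Rmin_l]).
  assert (h1 : Cmod h < d1).
  { eapply Rlt_le_trans; [exact Hh|]. eapply Rle_trans; [apply Rmin_r|apply Rmin_l]. }
  assert (h2 : Cmod h < d2).
  { eapply Rlt_le_trans; [exact Hh|]. eapply Rle_trans; [apply Rmin_r|apply Rmin_r]. }
  assert (BB : forall d : R, Cmod h < d -> ball z d (z + h)%C).
  { intros d Hd. generalize (re_le_Cmod h) (Im_le_Cmod h). intros hr hi.
    destruct z as [x y], h as [u v]. unfold Re, Im in hr, hi. simpl in hr, hi.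
    split; simpl; unfold ball; simpl; unfold AbsRing_ball, abs, minus, plus, opp; simpl.
    - replace (x + u + - x) with u by ring. lra.
    - replace (y + v + - y) with v by ring. lra. }
  specialize (H1 _ (BB _ h1)). specialize (H2 _ (BB _ h2)).
  change (Rabs (ln (sqrt (Re (z + h)%C * Re (z + h)%C + Im (z + h)%C * Im (z + h)%C))
    - ln (sqrt (Re z * Re z + Im z * Im z))) < eps / 2) in H1.
  change (Rabs (atan (Im (z + h)%C / Re (z + h)%C) - atan (Im z / Re z)) < eps / 2) in H2.
  rewrite !EM in H1.
  eapply Rle_lt_trans; [apply Cmod_le_Rabs_Re_Im|].
  assert (Hzh : 0 < Re (z + h)%C).
  { generalize (re_le_Cmod h). intros hr. apply Rabs_le_between in hr.
    destruct z, h. simpl in *. lra. }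
  unfold Clog. rewrite !Carg_right_half_plane by assumption.
  change (Rabs (ln (Cmod (z + h)%C) - ln (Cmod z))
    + Rabs (atan (Im (z + h)%C / Re (z + h)%C) - atan (Im z / Re z)) < eps).
  lra.
Qed.

Lemma has_C_derivative_Clog (z : C) : 0 < Re z -> has_C_derivative Clog z (/ z)%C.
Proof.
  intros Hz.
  assert (N : forall w : C, 0 < Re w -> w <> 0%C).
  { intros w Hw ->. simpl in Hw. lra. }
  (* The disc of radius [Re z] about [z] stays in the right half-plane and so avoids [0]. *)
  apply (has_C_derivative_inverse_function Cexp Clog z z (Re z)); auto.
  - rewrite <- (Cexp_Clog z) at 2 by auto. apply has_C_derivative_Cexp.
  - intros w Hw. apply Cexp_Clog, N.
    generalize (re_le_Cmod (w - z)%C). intros hr.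
    assert (E : Re (w - z)%C = Re w - Re z) by (destruct w, z; simpl; ring).
    rewrite E in hr. apply Rabs_le_between in hr. lra.
  - apply Clog_continuous. exact Hz.
Qed.

Lemma has_C_derivative_Cpower (z a : C) :
  0 < Re z -> exists l, has_C_derivative (fun w => Cpower w a) z l.
Proof.
  intros Hz. eexists. unfold Cpower.
  apply (has_C_derivative_comp Cexp (fun w => (a * Clog w)%C)).
  - apply has_C_derivative_Cexp.
  - apply (has_C_derivative_ext_loc (fun w => (a * Clog w + 0)%C) _ z _ 1); [lra| |].
    + intros; ring.
    + apply (has_C_derivative_comp (fun w => (a * w + 0)%C) Clog).
      * apply has_C_derivative_affine.
      * apply has_C_derivative_Clog. exact Hz.
Qed.

(** * Entire power series *)

Definition C_series (t : nat -> C) (l : C) : Prop :=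
  is_series (K := C_AbsRing) (V := C_NormedModule) t l.

(** The same [iota] term as in [bessel_u], so that the Bessel function is convertible to an instance
    of it. *)
Definition pseries_sum (a : nat -> C) (z : C) : C :=
  iota (T := C_CompleteNormedModule)
    (is_pseries (K := C_AbsRing) (V := C_NormedModule) a z).

Definition pseries_derive (a : nat -> C) (n : nat) : C := (RtoC (INR (S n)) * a (S n))%C.

Lemma C_series_ext (s t : nat -> C) (l : C) :
  (forall n, s n = t n) -> C_series s l -> C_series t l.
Proof. intros H. apply is_series_ext. exact H. Qed.

Lemma C_series_plus (s t : nat -> C) (l m : C) :
  C_series s l -> C_series t m -> C_series (fun n => s n + t n)%C (l + m)%C.
Proof. intros. apply (is_series_plus (K := C_AbsRing) (V := C_NormedModule)); assumption. Qed.

Lemma C_series_scal (c : C) (s : nat -> C) (l : C) :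
  C_series s l -> C_series (fun n => c * s n)%C (c * l)%C.
Proof. intros. apply (is_series_scal (K := C_AbsRing) (V := C_NormedModule)); assumption. Qed.

Lemma C_series_shift (s : nat -> C) (l : C) :
  s 0%nat = 0%C -> C_series (fun n => s (S n)) l -> C_series s l.
Proof.
  intros H0 H. apply (is_series_decr_1 (K := C_AbsRing) (V := C_NormedModule)).
  change (C_series (fun n => s (S n)) (l + - s 0%nat)%C).
  replace (l + - s 0%nat)%C with l; [exact H|]. rewrite H0. ring.
Qed.

Lemma C_series_unique (s : nat -> C) (l m : C) : C_series s l -> C_series s m -> l = m.
Proof.
  apply (filterlim_locally_unique (K := C_AbsRing) (V := C_NormedModule)).
Qed.

Lemma C_series_norm_le (s : nat -> C) (b : nat -> R) (l : C) (L : R) :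
  (forall n, Cmod (s n) <= b n) -> C_series s l -> is_series b L -> Cmod l <= L.
Proof.
  intros Hb Hs Hl.
  apply (filterlim_le (F := eventually) (fun n => Cmod (sum_n s n)) (sum_n b) (Cmod l) L).
  - exists 0%nat. intros n _. unfold sum_n.
    eapply Rle_trans; [apply (norm_sum_n_m (K := C_AbsRing) (V := C_NormedModule))|].
    apply sum_n_m_le. exact Hb.
  - apply (filterlim_comp _ _ _ (sum_n s) Cmod _ (locally (l : C_NormedModule))); [exact Hs|].
    apply (filterlim_norm (K := C_AbsRing) (V := C_NormedModule)).
  - exact Hl.
Qed.

Lemma C_series_zero (s : nat -> C) (l : C) : (forall n, s n = 0%C) -> C_series s l -> l = 0%C.
Proof.
  intros Hs Hl. apply Cmod_eq_0. apply Rle_antisym; [|apply Cmod_ge_0].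
  (* The majorant is [0] times the geometric series of ratio [0], with its sum in the shape given by
     [is_series_geom]. *)
  replace 0 with (0 * / (1 - 0)) by ring.
  refine (C_series_norm_le _ (fun n => 0 * 0 ^ n) _ _ _ Hl
      (is_series_scal (K := R_AbsRing) (V := R_NormedModule) 0 _ _
         (is_series_geom 0 ltac:(rewrite Rabs_R0; lra)))).
  intros n. right. rewrite Hs, Cmod_0, Rmult_0_l. reflexivity.
Qed.

(** Infinite radius of convergence, stated through bounded terms: this passes easily to derived
    coefficients, and enlarging [M] by a constant factor recovers absolute summability. *)
Definition entire_coeff (a : nat -> C) : Prop :=
  forall M : R, exists B : R, forall n : nat, Cmod (a n) * M ^ n <= B.

Lemma sqr_INR_le_pow4 (n : nat) : INR n * INR n <= 4 ^ n.
Proof.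
  induction n as [|n IH]; [simpl; lra|].
  rewrite S_INR. change (4 ^ S n) with (4 * 4 ^ n).
  assert (1 <= 4 ^ n) by (apply pow_R1_Rle; lra).
  assert (P := pos_INR n). nra.
Qed.

(** In the weight, [1] serves convergence of the series itself and [n^2] the second-order remainder
    of [(z + h)^n]. *)
Lemma entire_coeff_summable (a : nat -> C) (M : R) :
  entire_coeff a -> 0 <= M -> ex_series (fun n => Cmod (a n) * (INR n * INR n + 1) * M ^ n).
Proof.
  (* [16^n = (4^n 2^n) 2^n]: the first factor absorbs [n^2 + 1], the second leaves a geometric
     series of ratio [1/2]. *)
  intros Ha HM. destruct (Ha (16 * M)) as [B HB].
  apply (ex_series_le (K := R_AbsRing) (V := R_CompleteNormedModule) _ (fun n => B * (/ 2) ^ n)).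
  - intros n. change (Rabs (Cmod (a n) * (INR n * INR n + 1) * M ^ n) <= B * (/ 2) ^ n).
    specialize (HB n). assert (P1 := Cmod_ge_0 (a n)). assert (P2 := pow_le M n HM).
    assert (P3 := sqr_INR_le_pow4 n). assert (P4 := Rle_0_sqr (INR n)). unfold Rsqr in P4.
    rewrite Rabs_pos_eq by (repeat apply Rmult_le_pos; lra).
    assert (P5 : 0 < 2 ^ n) by (apply pow_lt; lra).
    rewrite pow_inv. apply Rmult_le_reg_r with (2 ^ n); [exact P5|].
    rewrite (Rmult_assoc B), Rinv_l, Rmult_1_r by lra.
    apply Rle_trans with (2 := HB). rewrite Rpow_mult_distr.
    replace (16 ^ n) with (4 ^ n * 2 ^ n * 2 ^ n)
      by (rewrite <- !Rpow_mult_distr; f_equal; ring).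
    replace (Cmod (a n) * (4 ^ n * 2 ^ n * 2 ^ n * M ^ n))
      with (Cmod (a n) * (4 ^ n * 2 ^ n) * M ^ n * 2 ^ n) by ring.
    apply Rmult_le_compat_r; [lra|]. apply Rmult_le_compat_r; [lra|].
    apply Rmult_le_compat_l; [lra|].
    assert (F : 4 ^ n = 2 ^ n * 2 ^ n) by (rewrite <- !Rpow_mult_distr; f_equal; ring).
    rewrite F in P3 |- *.
    destruct n as [|n]; [simpl; lra|].
    assert (1 <= 2 ^ n) by (apply pow_R1_Rle; lra).
    assert (2 <= 2 ^ S n) by (simpl; lra). set (t := 2 ^ S n) in *.
    assert (4 <= t * t) by nra.
    apply Rle_trans with (t * t * 2); [lra|]. apply Rmult_le_compat_l; lra.
  - apply (ex_series_scal (K := R_AbsRing) (V := R_NormedModule) B).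
    apply ex_series_geom. rewrite Rabs_pos_eq; lra.
Qed.

Lemma pseries_sum_correct (a : nat -> C) (z : C) :
  entire_coeff a -> C_series (fun n => z ^ n * a n)%C (pseries_sum a z).
Proof.
  intros Ha.
  assert (E : ex_series (K := C_AbsRing) (V := C_CompleteNormedModule) (fun n => z ^ n * a n)%C).
  { eapply ex_series_le; [|exact (entire_coeff_summable a (Cmod z) Ha (Cmod_ge_0 z))].
    intros n. change (Cmod (z ^ n * a n)%C <= Cmod (a n) * (INR n * INR n + 1) * Cmod z ^ n).
    rewrite Cmod_mult, Cmod_pow.
    assert (P1 := Cmod_ge_0 (a n)). assert (P2 := pow_le _ n (Cmod_ge_0 z)).
    assert (P4 := Rle_0_sqr (INR n)). unfold Rsqr in P4.
    assert (0 <= Cmod (a n) * (INR n * INR n) * Cmod z ^ n)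
      by (repeat apply Rmult_le_pos; try lra; apply pos_INR). lra. }
  destruct E as [l Hl].
  assert (X : forall y, is_pseries (K := C_AbsRing) (V := C_NormedModule) a z y
                        <-> C_series (fun n => z ^ n * a n)%C y).
  { intros y. split; apply is_series_ext; reflexivity. }
  unfold pseries_sum. rewrite (iota_unique _ l); [exact Hl| |].
  - intros y Hy. apply X in Hy. exact (C_series_unique _ _ _ Hy Hl).
  - apply X. exact Hl.
Qed.

Lemma entire_coeff_derive (a : nat -> C) : entire_coeff a -> entire_coeff (pseries_derive a).
Proof.
  (* The factor [2] absorbs [n + 1 <= 2^(n+1)]; the maximum with [1] pays for the index shift from
     [M^n] to a power [n + 1]. *)
  intros Ha M. destruct (Ha (2 * Rmax 1 (Rabs M))) as [B HB].
  exists B. intros n. specialize (HB (S n)). apply Rle_trans with (2 := HB).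
  assert (M1 : 1 <= Rmax 1 (Rabs M)) by apply Rmax_l.
  assert (M2 : Rabs M <= Rmax 1 (Rabs M)) by apply Rmax_r.
  set (N := Rmax 1 (Rabs M)) in *.
  unfold pseries_derive. rewrite Cmod_mult, Cmod_R, Rabs_pos_eq by apply pos_INR.
  rewrite Rpow_mult_distr.
  assert (H1 : INR (S n) <= 2 ^ S n).
  { clear. induction n as [|n IH]; [simpl; lra|].
    rewrite S_INR. change (2 ^ S (S n)) with (2 * 2 ^ S n).
    assert (1 <= 2 ^ S n) by (apply pow_R1_Rle; lra). lra. }
  assert (H2 : M ^ n <= N ^ S n).
  { apply Rle_trans with (N ^ n).
    - apply Rle_trans with (1 := Rle_abs _). rewrite <- RPow_abs.
      apply pow_incr. split; [apply Rabs_pos|exact M2].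
    - apply Rle_pow; [exact M1|lia]. }
  assert (P1 := Cmod_ge_0 (a (S n))). assert (P2 := pos_INR (S n)).
  assert (0 < N ^ S n) by (apply pow_lt; lra).
  apply Rle_trans with (INR (S n) * Cmod (a (S n)) * N ^ S n).
  - apply Rmult_le_compat_l; [apply Rmult_le_pos; lra|exact H2].
  - replace (Cmod (a (S n)) * (2 ^ S n * N ^ S n)) with (2 ^ S n * Cmod (a (S n)) * N ^ S n) by ring.
    repeat apply Rmult_le_compat_r; lra.
Qed.

(** The remainders satisfy [E_(n+1) = (z + h) E_n + n z^(n-1) h^2], and [n^2 + n <= (n + 1)^2]
    closes the induction. At [n = 0] the truncated [pred] is harmless because of the factor
    [INR n]. *)
Lemma Cpow_Taylor1_bound (z h : C) (n : nat) : Cmod h <= 1 ->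
  Cmod ((z + h) ^ n - z ^ n - RtoC (INR n) * z ^ pred n * h)%C
  <= Cmod h * Cmod h * ((INR n * INR n) * (Cmod z + 1) ^ n).
Proof.
  intros Hh. assert (Pz := Cmod_ge_0 z). assert (Ph := Cmod_ge_0 h).
  set (M := Cmod z + 1).
  induction n as [|n IH].
  - simpl Cpow. replace (1 - 1 - RtoC (INR 0) * 1 * h)%C with (RtoC 0) by (simpl; ring).
    rewrite Cmod_0. simpl. nra.
  - set (E := ((z + h) ^ n - z ^ n - RtoC (INR n) * z ^ pred n * h)%C) in *.
    assert (Q : (RtoC (INR n) * z ^ n = RtoC (INR n) * z ^ pred n * z)%C).
    { destruct n; [simpl; ring|]. simpl pred. rewrite Cpow_S. ring. }
    replace ((z + h) ^ S n - z ^ S n - RtoC (INR (S n)) * z ^ pred (S n) * h)%C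
      with ((z + h) * E + RtoC (INR n) * z ^ pred n * (h * h))%C.
    2: { simpl pred. rewrite !Cpow_S, S_INR, RtoC_plus. unfold E.
         replace ((RtoC (INR n) + RtoC 1) * z ^ n * h)%C
           with (RtoC (INR n) * z ^ n * h + z ^ n * h)%C by ring.
         rewrite Q. ring. }
    eapply Rle_trans; [apply Cmod_triangle|].
    rewrite !Cmod_mult, Cmod_pow, Cmod_R, (Rabs_pos_eq (INR n)) by apply pos_INR.
    assert (A1 : Cmod (z + h)%C <= M).
    { eapply Rle_trans; [apply Cmod_triangle|]. unfold M; lra. }
    assert (A2 : Cmod z ^ pred n <= M ^ S n).
    { apply Rle_trans with (M ^ pred n).
      - apply pow_incr. unfold M; lra.
      - apply Rle_pow; [unfold M; lra|lia]. }
    assert (A3 : 0 < M ^ n) by (apply pow_lt; unfold M; lra).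
    assert (Pn := pos_INR n).
    assert (A4 : Cmod (z + h)%C * Cmod E <= M * (Cmod h * Cmod h * (INR n * INR n * M ^ n))).
    { apply Rmult_le_compat; try apply Cmod_ge_0; assumption. }
    assert (A5 : INR n * Cmod z ^ pred n * (Cmod h * Cmod h) <= INR n * M ^ S n * (Cmod h * Cmod h)).
    { apply Rmult_le_compat_r; [nra|]. apply Rmult_le_compat_l; assumption. }
    rewrite S_INR. change (M ^ S n) with (M * M ^ n) in *.
    assert (A6 : 0 <= (Cmod h * Cmod h) * (M * M ^ n) * (INR n + 1)).
    { assert (0 < M) by (unfold M; lra). repeat apply Rmult_le_pos; lra. }
    lra.
Qed.

(** Summing the remainders of the monomials bounds the error by [|h|^2 L], where [L] is the weighted
    sum at radius [|z| + 1]. *)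
Lemma has_C_derivative_pseries_sum (a : nat -> C) (z : C) :
  entire_coeff a ->
  has_C_derivative (pseries_sum a) z (pseries_sum (pseries_derive a) z).
Proof.
  intros Ha eps Heps. assert (Hd := entire_coeff_derive a Ha).
  assert (Pz := Cmod_ge_0 z).
  destruct (entire_coeff_summable a (Cmod z + 1) Ha ltac:(lra)) as [L HL].
  assert (PL : 0 <= Rabs L) by apply Rabs_pos.
  exists (Rmin 1 (eps / (Rabs L + 1))). split.
  { apply Rmin_pos; [lra|]. apply Rdiv_lt_0_compat; lra. }
  intros h Hh.
  assert (h1 : Cmod h < 1) by (eapply Rlt_le_trans; [exact Hh|apply Rmin_l]).
  assert (h2 : Cmod h < eps / (Rabs L + 1)) by (eapply Rlt_le_trans; [exact Hh|apply Rmin_r]).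
  assert (Ph := Cmod_ge_0 h).
  assert (S1 := pseries_sum_correct a (z + h)%C Ha).
  assert (S2 := C_series_scal (- (1))%C _ _ (pseries_sum_correct a z Ha)).
  assert (S3 : C_series (fun n => RtoC (INR n) * z ^ pred n * a n)%C (pseries_sum (pseries_derive a) z)).
  { apply C_series_shift; [simpl; ring|].
    eapply C_series_ext; [|exact (pseries_sum_correct _ z Hd)].
    intros n. unfold pseries_derive. simpl pred. ring. }
  assert (S4 := C_series_plus _ _ _ _ (C_series_plus _ _ _ _ S1 S2) (C_series_scal (- h)%C _ _ S3)).
  apply Rle_trans with (Cmod h * Cmod h * L).
  - replace (pseries_sum a (z + h) - pseries_sum a z - pseries_sum (pseries_derive a) z * h)%C
      with (pseries_sum a (z + h) + - (1) * pseries_sum a z + - h * pseries_sum (pseries_derive a) z)%C by ring.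
    refine (C_series_norm_le _ _ _ _ _ S4
      (is_series_scal (K := R_AbsRing) (V := R_NormedModule) (Cmod h * Cmod h) _ _ HL)).
    intros n.
    replace ((z + h) ^ n * a n + - (1) * (z ^ n * a n) + - h * (RtoC (INR n) * z ^ pred n * a n))%C
      with (a n * ((z + h) ^ n - z ^ n - RtoC (INR n) * z ^ pred n * h))%C by ring.
    rewrite Cmod_mult.
    assert (P1 := Cmod_ge_0 (a n)).
    eapply Rle_trans; [apply Rmult_le_compat_l; [exact P1|apply Cpow_Taylor1_bound; lra]|].
    change (Cmod (a n) * (Cmod h * Cmod h * (INR n * INR n * (Cmod z + 1) ^ n))
      <= (Cmod h * Cmod h) * (Cmod (a n) * (INR n * INR n + 1) * (Cmod z + 1) ^ n)).
    assert (0 <= Cmod h * Cmod h * Cmod (a n) * (Cmod z + 1) ^ n); [|lra].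
    repeat apply Rmult_le_pos; try lra. apply pow_le. lra.
  - apply Rle_trans with (Cmod h * (Cmod h * (Rabs L + 1))).
    + generalize (Rle_abs L). intros. rewrite Rmult_assoc.
      repeat apply Rmult_le_compat_l; lra.
    + rewrite (Rmult_comm eps). apply Rmult_le_compat_l; [lra|].
      replace eps with (eps / (Rabs L + 1) * (Rabs L + 1)) by (field; lra).
      apply Rmult_le_compat_r; lra.
Qed.

Lemma pseries_sum_0 (a : nat -> C) : entire_coeff a -> pseries_sum a 0 = a 0%nat.
Proof.
  intros Ha. assert (S1 := pseries_sum_correct a 0 Ha).
  assert (E : (pseries_sum a 0 - a 0%nat = 0)%C).
  { apply (C_series_zero (fun n => 0 ^ S n * a (S n))%C).
    - intros n. rewrite Cpow_S. ring.
    - apply (is_series_incr_1 (K := C_AbsRing) (V := C_NormedModule) (fun n => 0 ^ n * a n)%C).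
      change (C_series (fun n => 0 ^ n * a n)%C (pseries_sum a 0 - a 0%nat + 1 * a 0%nat)%C).
      replace (pseries_sum a 0 - a 0%nat + 1 * a 0%nat)%C with (pseries_sum a 0) by ring.
      exact S1. }
  replace (pseries_sum a 0) with (pseries_sum a 0 - a 0%nat + a 0%nat)%C by ring.
  rewrite E. ring.
Qed.

(** The hypothesis says that the coefficient of [z^n] on the left vanishes; the factor [n (n + 1)]
    comes from [z u''] after shifting the index. *)
Lemma pseries_sum_ode (a : nat -> C) (k d z : C) :
  entire_coeff a ->
  (forall n, RtoC (INR (S n)) * (RtoC (INR n) + k) * a (S n) + d * a n = 0)%C ->
  (z * pseries_sum (pseries_derive (pseries_derive a)) z
   + k * pseries_sum (pseries_derive a) z + d * pseries_sum a z = 0)%C.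
Proof.
  intros Ha Hrec. assert (Hd := entire_coeff_derive a Ha).
  assert (Hdd := entire_coeff_derive _ Hd).
  assert (S1 : C_series (fun n => RtoC (INR n) * RtoC (INR (S n)) * z ^ n * a (S n))%C
    (z * pseries_sum (pseries_derive (pseries_derive a)) z)%C).
  { apply C_series_shift; [simpl; ring|].
    eapply C_series_ext; [|exact (C_series_scal z _ _ (pseries_sum_correct _ z Hdd))].
    intros n. unfold pseries_derive. rewrite (Cpow_S z n). ring. }
  assert (S2 := C_series_scal k _ _ (pseries_sum_correct _ z Hd)).
  assert (S3 := C_series_scal d _ _ (pseries_sum_correct _ z Ha)).
  assert (S4 := C_series_plus _ _ _ _ (C_series_plus _ _ _ _ S1 S2) S3).
  apply (C_series_zero _ _) with (2 := S4). intros n.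
  unfold pseries_derive.
  transitivity (z ^ n * (RtoC (INR (S n)) * (RtoC (INR n) + k) * a (S n) + d * a n))%C; [ring|].
  rewrite Hrec. ring.
Qed.

(** * Barrier arguments along rays *)

Lemma is_derive_continuity_eps (f : R -> R) (x l eps : R) :
  is_derive f x l -> 0 < eps -> exists delta, 0 < delta /\
    forall h, Rabs h < delta -> Rabs (f (x + h) - f x) < eps.
Proof.
  intros Hf Heps. apply is_derive_Reals in Hf.
  destruct (Hf 1 Rlt_0_1) as [d Hd].
  assert (P := Rabs_pos l).
  exists (Rmin d (eps / (Rabs l + 1))). split.
  { apply Rmin_pos; [apply cond_pos|apply Rdiv_lt_0_compat; lra]. }
  intros h Hh.
  assert (h1 : Rabs h < d) by (eapply Rlt_le_trans; [exact Hh|apply Rmin_l]).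
  assert (h2 : Rabs h < eps / (Rabs l + 1)) by (eapply Rlt_le_trans; [exact Hh|apply Rmin_r]).
  destruct (Req_dec h 0) as [->|H0].
  { rewrite Rplus_0_r, Rminus_diag, Rabs_R0. exact Heps. }
  specialize (Hd h H0 h1).
  replace (f (x + h) - f x) with (((f (x + h) - f x) / h - l + l) * h) by (field; exact H0).
  rewrite Rabs_mult.
  assert (P1 : 0 < Rabs h) by (apply Rabs_pos_lt; exact H0).
  apply Rle_lt_trans with ((Rabs l + 1) * Rabs h).
  - apply Rmult_le_compat_r; [lra|]. eapply Rle_trans; [apply Rabs_triang|lra].
  - replace eps with ((Rabs l + 1) * (eps / (Rabs l + 1))) by (field; lra).
    apply Rmult_lt_compat_l; lra.
Qed.

(* At the first zero the function would have to be nondecreasing. *)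
Lemma negative_of_derive_neg_at_zeros (f f' : R -> R) :
  (forall t, 0 <= t <= 1 -> is_derive f t (f' t)) ->
  f 0 < 0 ->
  (forall t, 0 < t <= 1 -> f t = 0 -> f' t < 0) ->
  f 1 < 0.
Proof.
  intros Hf H0 Hz.
  (* Negativity is required on all of [[0, t]], so the supremum [m] is the first place where it can
     fail. *)
  set (S := fun t => 0 <= t <= 1 /\ forall s, 0 <= s <= t -> f s < 0).
  assert (S0 : S 0).
  { split; [lra|]. intros s Hs. replace s with 0 by lra. exact H0. }
  destruct (completeness S) as [m [Hub Hlub]].
  { exists 1. intros t [Ht _]. lra. }
  { exists 0. exact S0. }
  assert (m0 : 0 <= m) by (apply Hub; exact S0).
  assert (m1 : m <= 1) by (apply Hlub; intros t [Ht _]; lra).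
  assert (below : forall s, 0 <= s < m -> f s < 0).
  { intros s Hs. destruct (Rlt_dec (f s) 0) as [|N]; [assumption|exfalso].
    assert (m <= s); [|lra]. apply Hlub. intros t [Ht1 Ht2].
    destruct (Rle_dec t s) as [|L]; [assumption|]. exfalso. apply N, Ht2. lra. }
  (* If [f m > 0] this is continuity; if [f m = 0] it is the negative slope at [m]. Either way it
     contradicts negativity to the left of [m]. *)
  assert (near : 0 <= f m -> exists d, 0 < d /\ forall h, 0 < h < d -> 0 < f (m - h)).
  { intros [P|Z].
    - destruct (is_derive_continuity_eps f m _ (f m) (Hf m (conj m0 m1)) P) as [d [Hd Hb]].
      exists d. split; [exact Hd|]. intros h Hh.
      assert (B := Hb (- h)). rewrite Rabs_Ropp, Rabs_pos_eq in B by lra.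
      specialize (B (proj2 Hh)). apply Rabs_lt_between in B. unfold Rminus. lra.
    - assert (mp : 0 < m).
      { destruct (Req_dec m 0) as [E|]; [rewrite E in Z|]; lra. }
      assert (N : f' m < 0) by (apply Hz; lra).
      assert (D := Hf m (conj m0 m1)). apply is_derive_Reals in D.
      destruct (D (- f' m) ltac:(lra)) as [d Hb].
      exists d. split; [apply cond_pos|]. intros h Hh.
      assert (B := Hb (- h) ltac:(lra)). rewrite Rabs_Ropp, Rabs_pos_eq in B by lra.
      specialize (B (proj2 Hh)). apply Rabs_lt_between in B.
      rewrite <- Z in B. unfold Rminus.
      assert (E : f (m + - h) = - h * ((f (m + - h) - 0) / - h)) by (field; lra).
      rewrite E. nra. }
  destruct (Rlt_dec (f m) 0) as [N|N].
  - destruct (Req_dec m 1) as [->|]; [exact N|exfalso].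
    destruct (is_derive_continuity_eps f m _ (- f m) (Hf m (conj m0 m1)) ltac:(lra))
      as [d [Hd Hb]].
    (* If [f m < 0] and [m < 1], continuity extends negativity up to [m + e], against the choice of
       [m]. *)
    set (e := Rmin (d / 2) (1 - m)).
    assert (e1 : 0 < e) by (apply Rmin_pos; lra).
    assert (e2 : e <= d / 2) by apply Rmin_l.
    assert (e3 : e <= 1 - m) by apply Rmin_r.
    assert (m + e <= m); [|lra]. apply Hub. split; [lra|].
    intros s Hs. destruct (Rlt_dec s m) as [|L]; [apply below; lra|].
    assert (B := Hb (s - m)). rewrite Rabs_pos_eq in B by lra.
    specialize (B ltac:(lra)). replace (m + (s - m)) with s in B by ring.
    apply Rabs_lt_between in B. lra.
  - exfalso. destruct near as [d [Hd Hb]]; [lra|].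
    assert (mp : 0 < m).
    { destruct (Req_dec m 0) as [E|]; [rewrite E in N|]; lra. }
    set (h := Rmin (d / 2) m).
    assert (h1 : 0 < h) by (apply Rmin_pos; lra).
    assert (h2 : h <= d / 2) by apply Rmin_l.
    assert (h3 : h <= m) by apply Rmin_r.
    assert (P := Hb h ltac:(lra)). assert (Q := below (m - h) ltac:(lra)). lra.
Qed.

Lemma has_C_derivative_ray (f : C -> C) (z l : C) (t : R) :
  has_C_derivative f (RtoC t * z)%C l ->
  is_derive (fun s => Re (f (RtoC s * z)%C)) t (Re (l * z)%C) /\
  is_derive (fun s => Im (f (RtoC s * z)%C)) t (Im (l * z)%C).
Proof.
  intros Hf. assert (Pz := Cmod_ge_0 z).
  assert (X : forall eps, 0 < eps -> exists delta : posreal, forall h, h <> 0 -> Rabs h < delta ->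
    Cmod (f (RtoC (t + h) * z)%C - f (RtoC t * z)%C - l * (RtoC h * z))%C < eps * Rabs h).
  { intros eps Heps.
    (* The [+ 1] covers [z = 0], and the factor [2] makes the final inequality strict. *)
    destruct (Hf (eps / (2 * (Cmod z + 1)))) as [d [Hd Hb]].
    { apply Rdiv_lt_0_compat; lra. }
    assert (Q : 0 < d / (Cmod z + 1)) by (apply Rdiv_lt_0_compat; lra).
    exists (mkposreal _ Q). simpl. intros h h0 Hh.
    assert (Ph : 0 < Rabs h) by (apply Rabs_pos_lt; exact h0).
    replace (RtoC (t + h) * z)%C with (RtoC t * z + RtoC h * z)%C by (rewrite RtoC_plus; ring).
    eapply Rle_lt_trans; [apply Hb|].
    - rewrite Cmod_mult, Cmod_R. apply Rle_lt_trans with (Rabs h * (Cmod z + 1)).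
      + apply Rmult_le_compat_l; lra.
      + replace d with (d / (Cmod z + 1) * (Cmod z + 1)) by (field; lra).
        apply Rmult_lt_compat_r; lra.
    - rewrite Cmod_mult, Cmod_R.
      apply Rle_lt_trans with (eps / (2 * (Cmod z + 1)) * (Rabs h * (Cmod z + 1))).
      + apply Rmult_le_compat_l; [|apply Rmult_le_compat_l; lra].
        left. apply Rdiv_lt_0_compat; lra.
      + replace (eps / (2 * (Cmod z + 1)) * (Rabs h * (Cmod z + 1)))
          with (eps * Rabs h / 2) by (field; lra).
        assert (0 < eps * Rabs h) by (apply Rmult_lt_0_compat; lra). lra. }
  split; apply is_derive_Reals; intros eps Heps;
    destruct (X eps Heps) as [d Hd]; exists d; intros h h0 Hh;
    specialize (Hd h h0 Hh); assert (Ph : 0 < Rabs h) by (apply Rabs_pos_lt; exact h0).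
  - set (E := (_ - _ - _)%C) in Hd. assert (B := Rle_lt_trans _ _ _ (re_le_Cmod E) Hd).
    match goal with |- Rabs ?g < _ => replace g with (Re E / h) end.
    + unfold Rdiv. rewrite Rabs_mult, Rabs_inv.
      apply Rmult_lt_reg_r with (Rabs h); [exact Ph|].
      rewrite Rmult_assoc, Rinv_l, Rmult_1_r by lra. exact B.
    + unfold E. destruct (f (RtoC (t + h) * z)%C), (f (RtoC t * z)%C), l, z. simpl. field. exact h0.
  - set (E := (_ - _ - _)%C) in Hd. assert (B := Rle_lt_trans _ _ _ (Im_le_Cmod E) Hd).
    match goal with |- Rabs ?g < _ => replace g with (Im E / h) end.
    + unfold Rdiv. rewrite Rabs_mult, Rabs_inv.
      apply Rmult_lt_reg_r with (Rabs h); [exact Ph|].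
      rewrite Rmult_assoc, Rinv_l, Rmult_1_r by lra. exact B.
    + unfold E. destruct (f (RtoC (t + h) * z)%C), (f (RtoC t * z)%C), l, z. simpl. field. exact h0.
Qed.

(** Cauchy-Schwarz for the plane vectors [(a, b)] and [(x, y)], the first being at most [s] times as
    long as the second. *)
Lemma Rabs_inner_le (a b x y s : R) :
  0 <= s -> a * a + b * b <= s * s * (x * x + y * y) ->
  Rabs (a * x + b * y) <= s * (x * x + y * y).
Proof.
  intros Hs H.
  assert (P : 0 <= x * x + y * y) by nra.
  rewrite <- (Rabs_pos_eq (s * (x * x + y * y))) by (apply Rmult_le_pos; lra).
  apply Rsqr_le_abs_0. unfold Rsqr.
  assert (CS : (a * x + b * y) * (a * x + b * y) <= (a * a + b * b) * (x * x + y * y)).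
  { generalize (Rle_0_sqr (a * y - b * x)). unfold Rsqr. lra. }
  apply Rle_trans with (1 := CS).
  apply Rle_trans with (s * s * (x * x + y * y) * (x * x + y * y)); [|lra].
  apply Rmult_le_compat_r; assumption.
Qed.

(* On [|f'| = alpha |f|] the equation gives
   [d/dt |f'(tz)|^2 / 2 - alpha^2 d/dt |f(tz)|^2 / 2
      <= (alpha |f|^2 / t) (|d| - k alpha + alpha^2) < 0]. *)
Lemma Cmod_derive_lt_of_ode (f f1 f2 : C -> C) (alpha k d : R) (z : C) :
  0 < alpha <= 1 -> Rabs d < alpha * (k - 1) ->
  (forall w, has_C_derivative f w (f1 w)) ->
  (forall w, has_C_derivative f1 w (f2 w)) ->
  (forall w, (w * f2 w + RtoC k * f1 w + RtoC d * f w = 0)%C) ->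
  (forall w, Cmod w < 1 -> f w <> 0%C) ->
  Cmod z < 1 -> Cmod (f1 z) < alpha * Cmod (f z).
Proof.
  intros Ha Hd D1 D2 Hode Hnz Hz.
  assert (Hk : 1 < k).
  { generalize (Rabs_pos d). intros. nra. }
  (* Squared moduli are polynomials in real and imaginary parts, hence differentiable even where
     [f1] vanishes. *)
  set (G := fun t : R =>
    (Re (f1 (RtoC t * z)%C) * Re (f1 (RtoC t * z)%C) + Im (f1 (RtoC t * z)%C) * Im (f1 (RtoC t * z)%C))
    - alpha * alpha * (Re (f (RtoC t * z)%C) * Re (f (RtoC t * z)%C)
                       + Im (f (RtoC t * z)%C) * Im (f (RtoC t * z)%C))).
  set (G' := fun t : R =>
    2 * (Re (f1 (RtoC t * z)%C) * Re (f2 (RtoC t * z) * z)%C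
         + Im (f1 (RtoC t * z)%C) * Im (f2 (RtoC t * z) * z)%C)
    - alpha * alpha * (2 * (Re (f (RtoC t * z)%C) * Re (f1 (RtoC t * z) * z)%C
                            + Im (f (RtoC t * z)%C) * Im (f1 (RtoC t * z) * z)%C))).
  assert (Hray : forall t, 0 <= t <= 1 -> Cmod (RtoC t * z)%C < 1).
  { intros t Ht. rewrite Cmod_mult, Cmod_R, Rabs_pos_eq by lra.
    apply Rle_lt_trans with (1 * Cmod z); [|lra].
    apply Rmult_le_compat_r; [apply Cmod_ge_0|lra]. }
  assert (Hpos : forall w, Cmod w < 1 -> 0 < Re (f w) * Re (f w) + Im (f w) * Im (f w)).
  { intros w Hw. rewrite <- Cmod_sqr. apply Hnz in Hw. apply Cmod_gt_0 in Hw. nra. }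
  assert (G1 : G 1 < 0).
  { apply (negative_of_derive_neg_at_zeros G G').
    - intros t _.
      destruct (has_C_derivative_ray f z _ t (D1 _)) as [X1 Y1].
      destruct (has_C_derivative_ray f1 z _ t (D2 _)) as [X2 Y2].
      unfold G, G'.
      set (fx := fun s => Re (f (RtoC s * z)%C)) in *.
      set (fy := fun s => Im (f (RtoC s * z)%C)) in *.
      set (gx := fun s => Re (f1 (RtoC s * z)%C)) in *.
      set (gy := fun s => Im (f1 (RtoC s * z)%C)) in *.
      apply (is_derive_ext (fun s => (gx s * gx s + gy s * gy s)
               - alpha * alpha * (fx s * fx s + fy s * fy s))); [reflexivity|].
      auto_derive.
      + repeat split; eexists; eassumption.
      + assert (EX1 : Derive (fun x : R => fx x) t = _) by exact (is_derive_unique _ _ _ X1).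
        assert (EY1 : Derive (fun x : R => fy x) t = _) by exact (is_derive_unique _ _ _ Y1).
        assert (EX2 : Derive (fun x : R => gx x) t = _) by exact (is_derive_unique _ _ _ X2).
        assert (EY2 : Derive (fun x : R => gy x) t = _) by exact (is_derive_unique _ _ _ Y2).
        rewrite EX1, EY1, EX2, EY2.
        unfold fx, fy, gx, gy. ring.
    - assert (E0 : (RtoC 0 * z)%C = 0%C) by ring.
      unfold G. rewrite E0.
      assert (P0 := Hpos 0%C ltac:(rewrite Cmod_0; lra)).
      (* At the origin the equation reduces to [k f1(0) = - d f(0)], and
         [|d| < alpha (k - 1) < alpha k]. *)
      assert (O := Hode 0%C).
      assert (Or : k * Re (f1 0%C) = - d * Re (f 0%C)).
      { apply (f_equal Re) in O. destruct (f2 0%C), (f1 0%C), (f 0%C). simpl in *. lra. }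
      assert (Oi : k * Im (f1 0%C) = - d * Im (f 0%C)).
      { apply (f_equal Im) in O. destruct (f2 0%C), (f1 0%C), (f 0%C). simpl in *. lra. }
      set (x := Re (f 0%C)) in *. set (y := Im (f 0%C)) in *.
      set (a := Re (f1 0%C)) in *. set (b := Im (f1 0%C)) in *.
      assert (E : k * k * (a * a + b * b) = d * d * (x * x + y * y)).
      { transitivity ((k * a) * (k * a) + (k * b) * (k * b)); [ring|]. rewrite Or, Oi. ring. }
      assert (dk : d * d < alpha * k * (alpha * k)).
      { apply Rsqr_lt_abs_1. rewrite (Rabs_pos_eq (alpha * k)); nra. }
      assert (d * d * (x * x + y * y) < alpha * k * (alpha * k) * (x * x + y * y))
        by (apply Rmult_lt_compat_r; assumption).
      apply Rmult_lt_reg_l with (k * k); [nra|]. lra.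
    - intros t Ht HG. unfold G in HG. unfold G'.
      assert (Hw := Hray t ltac:(lra)).
      assert (P := Hpos _ Hw). assert (O := Hode (RtoC t * z)%C).
      assert (W := Cmod_sqr (RtoC t * z)%C).
      assert (W1 : Cmod (RtoC t * z)%C * Cmod (RtoC t * z)%C <= 1).
      { assert (Q := Cmod_ge_0 (RtoC t * z)%C). nra. }
      rewrite W in W1. clear W Hw.
      set (w := (RtoC t * z)%C) in *.
      assert (wr : Re w = t * Re z) by (unfold w; destruct z; simpl; ring).
      assert (wi : Im w = t * Im z) by (unfold w; destruct z; simpl; ring).
      assert (Or : t * Re (f2 w * z)%C = - k * Re (f1 w) - d * Re (f w)).
      { apply (f_equal Re) in O. destruct (f2 w), (f1 w), (f w), w, z. simpl in *. subst. lra. }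
      assert (Oi : t * Im (f2 w * z)%C = - k * Im (f1 w) - d * Im (f w)).
      { apply (f_equal Im) in O. destruct (f2 w), (f1 w), (f w), w, z. simpl in *. subst. lra. }
      assert (Vr : t * Re (f1 w * z)%C = Re (f1 w) * Re w - Im (f1 w) * Im w).
      { rewrite wr, wi. destruct (f1 w), z. simpl. ring. }
      assert (Vi : t * Im (f1 w * z)%C = Re (f1 w) * Im w + Im (f1 w) * Re w).
      { rewrite wr, wi. destruct (f1 w), z. simpl. ring. }
      (* Multiplying by [t] turns [z f2(tz)] into [w f2(w)] with [w = t z], which the equation
         expresses through [f1] and [f]. *)
      apply Rmult_lt_reg_l with t; [lra|]. rewrite Rmult_0_r.
      match goal with |- t * (2 * (?a * ?A + ?b * ?B) - ?c * (2 * (?x * ?X + ?y * ?Y))) < 0 =>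
        replace (t * (2 * (a * A + b * B) - c * (2 * (x * X + y * Y))))
        with (2 * (a * (t * A) + b * (t * B) - c * (x * (t * X) + y * (t * Y)))) by ring end.
      rewrite Or, Oi, Vr, Vi. clear Or Oi Vr Vi O wr wi.
      set (x := Re (f w)) in *. set (y := Im (f w)) in *.
      set (a := Re (f1 w)) in *. set (b := Im (f1 w)) in *.
      set (p := Re w) in *. set (q := Im w) in *.
      assert (E : a * a + b * b = alpha * alpha * (x * x + y * y)) by lra.
      assert (I1 := Rabs_inner_le a b x y alpha ltac:(lra) ltac:(lra)).
      (* The left side is the modulus of the real part of [f1(w) w] times the conjugate of [f(w)];
         here [|w| <= 1] is used. *)
      assert (I2 : Rabs ((a * p - b * q) * x + (a * q + b * p) * y) <= alpha * (x * x + y * y)).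
      { apply Rabs_inner_le; [lra|]. rewrite <- E.
        replace ((a * p - b * q) * (a * p - b * q) + (a * q + b * p) * (a * q + b * p))
          with ((a * a + b * b) * (p * p + q * q)) by ring.
        rewrite <- (Rmult_1_r (a * a + b * b)) at 2.
        apply Rmult_le_compat_l; [rewrite E; nra|exact W1]. }
      set (r := x * x + y * y) in *.
      assert (J1 : - d * (a * x + b * y) <= Rabs d * (alpha * r)).
      { apply Rle_trans with (Rabs (- d * (a * x + b * y))); [apply Rle_abs|].
        rewrite Rabs_mult, Rabs_Ropp. apply Rmult_le_compat_l; [apply Rabs_pos|exact I1]. }
      assert (J2 : - ((a * p - b * q) * x + (a * q + b * p) * y) <= alpha * r).
      { apply Rabs_le_between in I2. lra. }
      assert (J3 : alpha * alpha * - ((a * p - b * q) * x + (a * q + b * p) * y)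
                   <= alpha * alpha * (alpha * r)).
      { apply Rmult_le_compat_l; [nra|exact J2]. }
      assert (T : a * (- k * a - d * x) + b * (- k * b - d * y)
        - alpha * alpha * (x * (a * p - b * q) + y * (a * q + b * p))
        <= alpha * r * (Rabs d - k * alpha + alpha * alpha)).
      { replace (a * (- k * a - d * x) + b * (- k * b - d * y))
          with (- k * (a * a + b * b) + - d * (a * x + b * y)) by ring.
        rewrite E. lra. }
      assert (0 < alpha * r) by (apply Rmult_lt_0_compat; lra).
      (* The assumption on [d] bounds this by [alpha (alpha - 1)], which is where [alpha <= 1]
         enters. *)
      assert (Rabs d - k * alpha + alpha * alpha < 0) by nra.
      assert (alpha * r * (Rabs d - k * alpha + alpha * alpha) < 0) by nra.
      lra. }
  unfold G in G1. replace (RtoC 1 * z)%C with z in G1 by ring.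
  rewrite <- !Cmod_sqr in G1.
  assert (Q1 := Cmod_ge_0 (f1 z)). assert (Q2 := Cmod_ge_0 (f z)).
  assert (Q3 : 0 <= alpha * Cmod (f z)) by (apply Rmult_le_pos; lra).
  apply Rsqr_incrst_0; [unfold Rsqr; lra|assumption|assumption].
Qed.

(* The phase [phi(t) = alpha t + e] turns faster than the argument of [f(tz)];
   starting at [e > 0] keeps [sin phi] positive. *)
Lemma Carg_lt_of_log_derive (f f1 : C -> C) (alpha : R) (z : C) :
  0 < alpha <= 1 ->
  (forall w, has_C_derivative f w (f1 w)) ->
  f 0%C = 1%C ->
  (forall w, Cmod w < 1 -> f w <> 0%C) ->
  (forall w, Cmod w < 1 -> Cmod (f1 w) < alpha * Cmod (f w)) ->
  Cmod z < 1 -> Rabs (Carg (f z)) < alpha * (PI / 2).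
Proof.
  intros Ha D1 F0 Hnz Hlog Hz.
  assert (Ppi := PI_RGT_0).
  assert (Ppi2 : 1 < PI / 2) by (generalize PI2_1; lra).
  (* Chosen so that the phase at [t = 1] is exactly [alpha * (PI / 2)]. *)
  set (e := alpha * (PI / 2 - 1)).
  assert (He : 0 < e) by (apply Rmult_lt_0_compat; lra).
  assert (Hae : alpha + e <= PI / 2) by (unfold e; nra).
  assert (Hray : forall t, 0 <= t <= 1 -> Cmod (RtoC t * z)%C < 1).
  { intros t Ht. rewrite Cmod_mult, Cmod_R, Rabs_pos_eq by lra.
    apply Rle_lt_trans with (1 * Cmod z); [|lra].
    apply Rmult_le_compat_r; [apply Cmod_ge_0|lra]. }
  set (X := fun s => Re (f (RtoC s * z)%C)).
  set (Y := fun s => Im (f (RtoC s * z)%C)).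
  set (X' := fun s => Re (f1 (RtoC s * z) * z)%C).
  set (Y' := fun s => Im (f1 (RtoC s * z) * z)%C).
  set (rho := fun s => sqrt (X s * X s + Y s * Y s)).
  (* [K < 0] says that the argument lies strictly between minus the phase and the phase, controlling
     both signs at once without differentiating [Carg]. *)
  set (K := fun s => rho s * cos (alpha * s + e) - X s).
  set (K' := fun s => (X s * X' s + Y s * Y' s) / rho s * cos (alpha * s + e)
                      - rho s * alpha * sin (alpha * s + e) - X' s).
  assert (Erho : forall s, rho s = Cmod (f (RtoC s * z)%C)).
  { intros s. unfold rho, X, Y. rewrite <- Cmod_sqr. apply sqrt_square, Cmod_ge_0. }
  assert (Prho : forall t, 0 <= t <= 1 -> 0 < rho t).
  { intros t Ht. rewrite Erho. apply Cmod_gt_0, Hnz, Hray, Ht. }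
  assert (Srho : forall s, rho s * rho s = X s * X s + Y s * Y s).
  { intros s. apply sqrt_sqrt. nra. }
  assert (K1 : K 1 < 0).
  { apply (negative_of_derive_neg_at_zeros K K').
    - intros t Ht.
      destruct (has_C_derivative_ray f z _ t (D1 _)) as [DX DY].
      fold (X' t) in DX. fold (Y' t) in DY. fold X in DX. fold Y in DY.
      assert (P := Prho t Ht). assert (Q := Srho t).
      unfold K, K', rho. auto_derive.
      + repeat split; try (eexists; eassumption). rewrite <- Q. nra.
      + assert (EX : Derive (fun x : R => X x) t = _) by exact (is_derive_unique _ _ _ DX).
        assert (EY : Derive (fun x : R => Y x) t = _) by exact (is_derive_unique _ _ _ DY).
        rewrite EX, EY.
        fold (rho t). field. lra.
    - unfold K. rewrite Erho. unfold X. replace (RtoC 0 * z)%C with (RtoC 0) by ring.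
      rewrite F0, Cmod_1. simpl. replace (alpha * 0 + e) with e by ring.
      assert (cos e < cos 0); [|rewrite cos_0 in *; lra].
      apply cos_decreasing_1; lra.
    - intros t Ht HK. unfold K in HK. unfold K'.
      assert (P := Prho t ltac:(lra)). assert (Q := Srho t).
      assert (V : X' t * X' t + Y' t * Y' t < (alpha * rho t) * (alpha * rho t)).
      { unfold X', Y'. rewrite <- Cmod_sqr, Cmod_mult, Erho.
        assert (L := Hlog _ (Hray t ltac:(lra))).
        assert (L0 := Cmod_ge_0 (f1 (RtoC t * z)%C)). assert (Z0 := Cmod_ge_0 z).
        assert (Cmod (f1 (RtoC t * z)%C) * Cmod z <= Cmod (f1 (RtoC t * z)%C)) by nra.
        assert (0 <= Cmod (f1 (RtoC t * z)%C) * Cmod z) by nra.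
        nra. }
      assert (phi : 0 < alpha * t + e < PI).
      { assert (0 < alpha * t) by nra. assert (alpha * t <= alpha) by nra. lra. }
      assert (S := sin_gt_0 _ (proj1 phi) (proj2 phi)).
      assert (T := sin2_cos2 (alpha * t + e)). unfold Rsqr in T.
      set (s := sin (alpha * t + e)) in *. set (c := cos (alpha * t + e)) in *.
      set (r := rho t) in *. set (x := X t) in *. set (y := Y t) in *.
      set (x' := X' t) in *. set (y' := Y' t) in *.
      assert (Hx : x = r * c) by lra.
      (* Since [v^2 = c^2], the vector [(-s, v)] is a unit vector, so its product with [(x', y')] is
         at most the speed, which is below [alpha r]. *)
      assert (CS : forall v, v * v = c * c -> - s * x' + v * y' < alpha * r).
      { intros v Hv.
        assert (B : (- s * x' + v * y') * (- s * x' + v * y') <= x' * x' + y' * y').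
        { assert (N := Rle_0_sqr (s * y' + v * x')). unfold Rsqr in N.
          assert (x' * x' + y' * y' = (s * s + v * v) * (x' * x' + y' * y')) by (rewrite Hv, T; ring).
          lra. }
        assert (0 < alpha * r) by (apply Rmult_lt_0_compat; lra).
        destruct (Rlt_dec (- s * x' + v * y') (alpha * r)); [assumption|nra]. }
      (* At a zero of [K] the value of [f] lies on one of the two rays at angle plus or minus the
         phase; the sign determines [v] below. *)
      assert (Hy : y = r * s \/ y = - (r * s)).
      { assert (F : (y - r * s) * (y + r * s) = 0).
        { transitivity (y * y - r * r * (s * s)); [ring|].
          replace (s * s) with (1 - c * c) by lra.
          rewrite Hx in Q. lra. }
        apply Rmult_integral in F. lra. }
      assert (Fin : exists v, v * v = c * c /\
        (x * x' + y * y') / r * c - r * alpha * s - x' = s * ((- s * x' + v * y') - alpha * r)).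
      { destruct Hy as [Hy|Hy]; [exists c|exists (- c)]; split; try ring; rewrite Hx, Hy.
        - replace ((r * c * x' + r * s * y') / r * c) with (c * c * x' + s * c * y') by (field; lra).
          replace (c * c) with (1 - s * s) by lra. ring.
        - replace ((r * c * x' + - (r * s) * y') / r * c) with (c * c * x' - s * c * y') by (field; lra).
          replace (c * c) with (1 - s * s) by lra. ring. }
      destruct Fin as [v [Hv ->]]. assert (B := CS v Hv). nra. }
  unfold K in K1. rewrite Erho in K1. unfold X in K1.
  replace (RtoC 1 * z)%C with z in K1 by ring.
  replace (alpha * 1 + e) with (alpha * (PI / 2)) in K1 by (unfold e; ring).
  assert (P := proj1 (Cmod_gt_0 _) (Hnz z Hz)).
  apply Rabs_Carg_lt; [exact (Hnz z Hz)| split; nra |].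
  apply Rmult_lt_reg_r with (Cmod (f z)); [exact P|].
  unfold Rdiv. rewrite Rmult_assoc, Rinv_l by lra. unfold Rdiv in K1. lra.
Qed.

(** * Bessel functions and subordination *)

(** The definition peels off the first factor, whereas the ratio of consecutive coefficients
    involves the last one. *)
Lemma pochhammer_S_r (l : C) (n : nat) :
  pochhammer l (S n) = (pochhammer l n * (l + RtoC (INR n)))%C.
Proof.
  revert l. induction n as [|n IH]; intros l; [simpl; ring|].
  change (pochhammer l (S (S n))) with (l * pochhammer (l + 1) (S n))%C.
  rewrite IH, S_INR, RtoC_plus.
  change (pochhammer l (S n)) with (l * pochhammer (l + 1) n)%C. ring.
Qed.

Lemma Cmod_pochhammer_ge_1 (k : R) (n : nat) : 1 <= k -> 1 <= Cmod (pochhammer (RtoC k) n).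
Proof.
  revert k. induction n as [|n IH]; intros k Hk; simpl pochhammer.
  - rewrite Cmod_1. lra.
  - rewrite <- RtoC_plus, Cmod_mult, Cmod_R, Rabs_pos_eq by lra.
    assert (H := IH (k + 1) ltac:(lra)). nra.
Qed.

Lemma RtoC_neq (x y : R) : x <> y -> RtoC x <> RtoC y.
Proof. intros H E. exact (H (f_equal Re E)). Qed.

Lemma bessel_k_RtoC (p b : R) : bessel_k (RtoC p) (RtoC b) = RtoC (p + (b + 1) / 2).
Proof.
  unfold bessel_k. rewrite RtoC_plus, RtoC_div, RtoC_plus; [reflexivity|lra].
Qed.

Lemma bessel_coeff_entire (p b : R) (c : C) :
  1 <= p + (b + 1) / 2 -> entire_coeff (bessel_coeff (RtoC p) (RtoC b) c).
Proof.
  intros Hk M. exists (exp (Cmod (- c / 4)%C * Rabs M)). intros n.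
  unfold bessel_coeff. rewrite bessel_k_RtoC.
  assert (P := Cmod_pochhammer_ge_1 _ n Hk). set (q := pochhammer _ n) in *.
  assert (F := INR_fact_lt_0 n).
  assert (N1 : q <> 0%C) by (apply Cmod_gt_0; lra).
  assert (N2 : RtoC (INR (fact n)) <> 0%C) by (apply RtoC_neq; lra).
  rewrite !Cmod_div, Cmod_pow, Cmod_R, (Rabs_pos_eq (INR _)) by (assumption || lra).
  set (t := Cmod (- c / 4)%C). assert (T : 0 <= t) by apply Cmod_ge_0.
  assert (T2 : 0 <= t ^ n) by (apply pow_le; exact T).
  assert (A0 : 0 <= Rabs M) by apply Rabs_pos.
  apply Rle_trans with ((t * Rabs M) ^ n / INR (fact n)).
  - rewrite Rpow_mult_distr. unfold Rdiv.
    rewrite (Rmult_assoc (t ^ n) (Rabs M ^ n)), (Rmult_comm (Rabs M ^ n)), <- Rmult_assoc.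
    assert (I : 0 <= t ^ n * / INR (fact n)).
    { apply Rmult_le_pos; [exact T2|]. left. apply Rinv_0_lt_compat. exact F. }
    apply Rle_trans with (t ^ n * / Cmod q * / INR (fact n) * Rabs M ^ n).
    + apply Rmult_le_compat_l.
      * repeat apply Rmult_le_pos; try assumption; left; apply Rinv_0_lt_compat; lra.
      * rewrite RPow_abs. apply Rle_abs.
    + apply Rmult_le_compat_r; [apply pow_le; exact A0|].
      apply Rmult_le_compat_r; [left; apply Rinv_0_lt_compat; exact F|].
      rewrite <- (Rmult_1_r (t ^ n)) at 2. apply Rmult_le_compat_l; [exact T2|].
      rewrite <- Rinv_1. apply Rinv_le_contravar; lra.
  - assert (G := exp_ge_taylor (t * Rabs M) n (Rmult_le_pos _ _ T A0)).
    eapply Rle_trans; [|exact G].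
    destruct n as [|n]; [simpl; lra|].
    rewrite tech5.
    assert (0 <= sum_f_R0 (fun k => (t * Rabs M) ^ k / INR (fact k)) n); [|lra].
    apply cond_pos_sum. intros j. apply Rmult_le_pos.
    + apply pow_le, Rmult_le_pos; assumption.
    + left. apply Rinv_0_lt_compat, INR_fact_lt_0.
Qed.

(** Consecutive coefficients have ratio [- (c/4) / ((n + 1) (k + n))]; [k >= 1] makes every
    denominator nonzero. *)
Lemma bessel_coeff_rec (p b c : R) (n : nat) :
  1 <= p + (b + 1) / 2 ->
  (RtoC (INR (S n)) * (RtoC (INR n) + RtoC (p + (b + 1) / 2)%R)
     * bessel_coeff (RtoC p) (RtoC b) (RtoC c) (S n)
   + RtoC (c / 4)%R * bessel_coeff (RtoC p) (RtoC b) (RtoC c) n = 0)%C.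
Proof.
  intros Hk. unfold bessel_coeff. rewrite bessel_k_RtoC.
  rewrite pochhammer_S_r, Cpow_S.
  assert (P := Cmod_pochhammer_ge_1 _ n Hk).
  set (k := p + (b + 1) / 2) in *. set (q := pochhammer _ n) in *.
  assert (F := INR_fact_lt_0 n). assert (In := pos_INR n).
  rewrite fact_simpl, mult_INR, RtoC_mult, RtoC_div by lra.
  assert (N1 : q <> 0%C) by (apply Cmod_gt_0; lra).
  assert (N2 : RtoC (INR (fact n)) <> 0%C) by (apply RtoC_neq; lra).
  assert (N3 : RtoC (INR (S n)) <> 0%C) by (apply RtoC_neq; rewrite S_INR; lra).
  assert (N4 : (RtoC k + RtoC (INR n))%C <> 0%C).
  { rewrite <- RtoC_plus. apply RtoC_neq. lra. }
  assert (N5 : RtoC 4 <> 0%C) by (apply RtoC_neq; lra).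
  field. repeat split; assumption.
Qed.

(** * The disc, the right half-plane and the maps between them *)

(** The real part equals [(1 - |z|^2) / |1 - z|^2]. *)
Lemma Re_mobius_pos (z : C) : Cmod z < 1 -> 0 < Re ((1 + z) / (1 - z))%C.
Proof.
  intros Hz. assert (E := Cmod_sqr z). assert (P := Cmod_ge_0 z).
  assert (L : Re z * Re z + Im z * Im z < 1) by (rewrite <- E; nra).
  destruct z as [x y]. unfold Re, Im in L; cbn [fst snd] in L. simpl.
  assert (D : 0 < (1 + - x) * (1 + - x) + (0 + - y) * (0 + - y)) by nra.
  match goal with |- 0 < ?g => replace g with
    ((1 - (x * x + y * y)) / ((1 + - x) * (1 + - x) + (0 + - y) * (0 + - y))) end.
  - apply Rdiv_lt_0_compat; lra.
  - field. nra.
Qed.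

(** A point of the right half-plane is closer to [1] than to [-1]. *)
Lemma Cmod_Cayley_lt_1 (P : C) : 0 < Re P -> Cmod ((P - 1) / (P + 1))%C < 1.
Proof.
  intros HP.
  assert (E1 := Cmod_sqr (P - 1)%C). assert (E2 := Cmod_sqr (P + 1)%C).
  assert (N1 := Cmod_ge_0 (P - 1)%C). assert (N2 := Cmod_ge_0 (P + 1)%C).
  assert (L : Cmod (P - 1)%C < Cmod (P + 1)%C).
  { apply Rsqr_incrst_0; [unfold Rsqr; rewrite E1, E2|assumption|assumption].
    destruct P as [x y]. simpl in *. nra. }
  assert (0 < Cmod (P + 1)%C) by lra.
  rewrite Cmod_div by (apply Cmod_gt_0; assumption).
  apply Rmult_lt_reg_r with (Cmod (P + 1)%C); [assumption|].
  unfold Rdiv. rewrite Rmult_assoc, Rinv_l by lra. lra.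
Qed.

Lemma has_C_derivative_Cayley (z : C) : (z + 1)%C <> 0%C ->
  exists l, has_C_derivative (fun w => (w - 1) / (w + 1))%C z l.
Proof.
  intros Hz. eexists.
  assert (P : 0 < Cmod (z + 1)%C) by (apply Cmod_gt_0; exact Hz).
  (* The map is [1 - 2 / (w + 1)], a composition of affine maps and inversion; the radius [|z + 1|]
     keeps [w] away from [-1]. *)
  apply (has_C_derivative_ext_loc (fun w => - (1 + 1) * / (1 * w + 1) + 1)%C _ z _ (Cmod (z + 1)%C) P).
  - intros w Hw. assert (N : (w + 1)%C <> 0%C).
    { intros N. replace (w - z)%C with (w + 1 - (z + 1))%C in Hw by ring.
      rewrite N in Hw. replace (0 - (z + 1))%C with (- (z + 1))%C in Hw by ring.
      rewrite Cmod_opp in Hw. lra. }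
    field. exact N.
  - apply (has_C_derivative_comp (fun v => - (1 + 1) * v + 1)%C (fun w => / (1 * w + 1))%C).
    + apply has_C_derivative_affine.
    + apply (has_C_derivative_comp Cinv (fun w => 1 * w + 1)%C).
      * apply has_C_derivative_Cinv. rewrite Cmult_1_l. exact Hz.
      * apply has_C_derivative_affine.
Qed.

Lemma analytic_Cpower_mobius (a : C) :
  analytic_on_disc (fun z => Cpower ((1 + z) / (1 - z))%C a).
Proof.
  intros z Hz. unfold in_disc in Hz.
  assert (Hn : forall w, Cmod w < 1 -> (1 - w)%C <> 0%C).
  { intros w Hw E. replace w with (1 - (1 - w))%C in Hw by ring.
    rewrite E in Hw. replace (1 - 0)%C with (RtoC 1) in Hw by ring.
    rewrite Cmod_1 in Hw. lra. }
  destruct (has_C_derivative_Cayley (- z)%C) as [l Hl].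
  { replace (- z + 1)%C with (1 - z)%C by ring. apply Hn, Hz. }
  destruct (has_C_derivative_Cpower _ a (Re_mobius_pos z Hz)) as [m Hm].
  eapply (has_C_derivative_ex_derive _ z).
  apply (has_C_derivative_comp (fun w => Cpower w a) (fun w => (1 + w) / (1 - w))%C).
  - exact Hm.
  (* [(1 + w) / (1 - w)] is minus the Cayley map at [-w]; the [+ 0] terms give the affine maps their
     expected shape. *)
  - apply (has_C_derivative_ext_loc
      (fun w => - (1) * (((- (1) * w + 0) - 1) / ((- (1) * w + 0) + 1)) + 0)%C _ z _ (1 - Cmod z)); [lra| |].
    + intros w Hw. assert (N := Hn w).
      assert (Cmod w < 1).
      { generalize (Cmod_minus_le w z). lra. }
      field. apply N; assumption.
    + apply (has_C_derivative_comp (fun v => - (1) * v + 0)%C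
        (fun w => ((- (1) * w + 0) - 1) / ((- (1) * w + 0) + 1))%C).
      * apply has_C_derivative_affine.
      * apply (has_C_derivative_comp (fun w => (w - 1) / (w + 1))%C (fun w => - (1) * w + 0)%C).
        -- replace (- (1) * z + 0)%C with (- z)%C by ring. exact Hl.
        -- apply has_C_derivative_affine.
Qed.

(** The Cayley map inverts [z |-> (1 + z) / (1 - z)], so the power to be recovered is [P^alpha]. The
    argument bound places [f] in the right half-plane, where the power is differentiable, and keeps
    [(1 / alpha) Clog f] in a strip on which [Clog] inverts [Cexp]. *)
Lemma subordinate_of_Carg_lt (f : C -> C) (alpha : R) :
  0 < alpha <= 1 ->
  (forall z, in_disc z -> exists l, has_C_derivative f z l) ->
  f 0%C = 1%C ->
  (forall z, in_disc z -> f z <> 0%C) ->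
  (forall z, in_disc z -> Rabs (Carg (f z)) < alpha * (PI / 2)) ->
  subordinate f (fun z : C => Cpower ((1 + z) / (1 - z))%C (RtoC alpha)).
Proof.
  intros Ha Hf f0 Hnz Harg. assert (Ppi := PI_RGT_0).
  split; [|split; [apply analytic_Cpower_mobius|]].
  { intros z Hz. destruct (Hf z Hz) as [l Hl]. exact (has_C_derivative_ex_derive _ _ _ Hl). }
  set (P := fun z => Cpower (f z) (RtoC (/ alpha))).
  assert (Hlog : forall z, in_disc z -> - (PI / 2) < Im (RtoC (/ alpha) * Clog (f z))%C < PI / 2).
  { intros z Hz. assert (B := Harg z Hz). apply Rabs_lt_between in B.
    assert (E : Im (RtoC (/ alpha) * Clog (f z))%C = / alpha * Carg (f z)).
    { unfold Clog. simpl. ring. }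
    rewrite E. split; apply Rmult_lt_reg_l with alpha; try lra;
      rewrite <- Rmult_assoc, Rinv_r, Rmult_1_l by lra; lra. }
  assert (HRe : forall z, in_disc z -> 0 < Re (P z)).
  { intros z Hz. assert (B := Hlog z Hz). unfold P, Cpower, Cexp.
    apply Rmult_lt_0_compat; [apply exp_pos|]. apply cos_gt_0; lra. }
  assert (HRef : forall z, in_disc z -> 0 < Re (f z)).
  { intros z Hz. assert (B := Harg z Hz). apply Rabs_lt_between in B.
    assert (PC := proj1 (Cmod_gt_0 _) (Hnz z Hz)).
    assert (C0 : 0 < cos (Carg (f z))) by (apply cos_gt_0; nra).
    rewrite cos_Carg in C0 by auto.
    replace (Re (f z)) with (Re (f z) / Cmod (f z) * Cmod (f z)) by (field; lra).
    apply Rmult_lt_0_compat; assumption. }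
  assert (HP1 : forall z, in_disc z -> (P z + 1)%C <> 0%C).
  { intros z Hz E. assert (R := HRe z Hz). apply (f_equal Re) in E.
    destruct (P z). simpl in *. lra. }
  assert (N2 : (1 + 1)%C <> 0%C).
  { rewrite <- RtoC_plus. apply RtoC_neq. lra. }
  exists (fun z => (P z - 1) / (P z + 1))%C. repeat split.
  - intros z Hz. destruct (Hf z Hz) as [l Hl].
    destruct (has_C_derivative_Cayley _ (HP1 z Hz)) as [m Hm].
    destruct (has_C_derivative_Cpower _ (RtoC (/ alpha)) (HRef z Hz)) as [n Hn].
    eapply (has_C_derivative_ex_derive _ z).
    apply (has_C_derivative_comp (fun w => (w - 1) / (w + 1))%C P); [exact Hm|].
    apply (has_C_derivative_comp (fun w => Cpower w (RtoC (/ alpha))) f); eassumption.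
  - intros z Hz. apply Cmod_Cayley_lt_1, HRe, Hz.
  - unfold P. rewrite f0. unfold Cpower.
    assert (E : Clog 1 = 0%C).
    { rewrite <- (Clog_Cexp 0%C) by (simpl; lra). f_equal.
      unfold Cexp. simpl. rewrite exp_0, cos_0, sin_0. unfold RtoC. f_equal; ring. }
    rewrite E, Cmult_0_r.
    replace (Cexp 0) with (RtoC 1).
    2: { unfold Cexp. simpl. rewrite exp_0, cos_0, sin_0. unfold RtoC. f_equal; ring. }
    field.
  - intros z Hz. assert (H1 := HP1 z Hz).
    replace ((1 + (P z - 1) / (P z + 1)) / (1 - (P z - 1) / (P z + 1)))%C with (P z).
    2: { field. split; [exact H1|].
         replace (P z + 1 - (P z - 1))%C with (RtoC 1 + RtoC 1)%C by ring. exact N2. }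
    (* The powers [1 / alpha] and [alpha] cancel because no multiple of [2 PI] is lost between
       them. *)
    unfold P, Cpower at 1 2. rewrite Clog_Cexp by (assert (B := Hlog z Hz); lra).
    rewrite Cmult_assoc, <- RtoC_mult, Rinv_r, Cmult_1_l by lra.
    symmetry. apply Cexp_Clog, Hnz, Hz.
Qed.

Theorem corollary2p8 (alpha p b c k : R)
  (Halpha : (0 < alpha <= 1)%R)
  (Hk : k = (p + (b + 1) / 2)%R)
  (Hc : (Rabs c < 4 * alpha * (k - 1))%R)
  (Hu : forall z : C, in_disc z -> bessel_u (RtoC p) (RtoC b) (RtoC c) z <> RtoC 0) :
  subordinate (bessel_u (RtoC p) (RtoC b) (RtoC c))
    (fun z : C => Cpower ((RtoC 1 + z) / (RtoC 1 - z))%C (RtoC alpha)).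
Proof.
  (* [0 <= |c| < 4 alpha (k - 1)] forces this, so the Bessel series is meaningful. *)
  assert (Hk1 : 1 < k) by (generalize (Rabs_pos c); nra).
  set (a := bessel_coeff (RtoC p) (RtoC b) (RtoC c)).
  change (bessel_u (RtoC p) (RtoC b) (RtoC c)) with (pseries_sum a) in *.
  assert (Ha : entire_coeff a) by (apply bessel_coeff_entire; lra).
  assert (Ha1 := entire_coeff_derive a Ha).
  assert (u0 : pseries_sum a 0%C = 1%C).
  { rewrite pseries_sum_0 by exact Ha. unfold a, bessel_coeff. simpl. field. }
  assert (Hd : Rabs (c / 4) < alpha * (k - 1)).
  { unfold Rdiv. rewrite Rabs_mult, (Rabs_pos_eq (/ 4)) by lra. lra. }
  apply subordinate_of_Carg_lt; try assumption.
  - intros z _. eexists. apply has_C_derivative_pseries_sum. exact Ha.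
  - intros z Hz.
    apply (Carg_lt_of_log_derive _ (pseries_sum (pseries_derive a))); try assumption.
    + intros w. apply has_C_derivative_pseries_sum. exact Ha.
    + intros w Hw.
      apply (Cmod_derive_lt_of_ode _ _ (pseries_sum (pseries_derive (pseries_derive a)))
               alpha k (c / 4)); try assumption.
      * intros v. apply has_C_derivative_pseries_sum. exact Ha.
      * intros v. apply has_C_derivative_pseries_sum. exact Ha1.
      * intros v. apply pseries_sum_ode; [exact Ha|]. intros n. subst k.
        apply bessel_coeff_rec. lra.
Qed.
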